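(* Let $F$ be a commutative field, $0\le h\le n-2$, and let $\chi:\Gamma(n,h+1,F)\to\mathrm{PG}(n,F)$ be a linear mapping with non-empty domain such that $V^\chi\in V$ (the point $V^\chi$ lies in $V$) for each $V\in\mathbb D(\chi)$. Then there is a unique linear complex $K$ of $h$-subspaces of $\mathrm{PG}(n,F)$ such that $\chi=\downarrow K$.
   Context: A $d$-subspace is a projective subspace of dimension $d$. Grassmannian $\Gamma(n,k,F)$: points are $k$-subspaces, lines are pencils $\{X:U\subset X\subset W,\dim X=k\}$ with $\dim U=k-1$, $\dim W=k+1$. A partial map $\chi$ has domain $\mathbb D(\chi)$, exceptional set $\mathbb A(\chi)$ (complement), $\phi^\chi=\{X^\chi:X\in\phi\cap\mathbb D(\chi)\}$; it is a linear mapping if for each line $\ell$ exactly one holds: (i) $\ell^\chi$ is a line and $\chi$ maps $\ell$ bijectively onto it; (ii) $\ell^\chi$ is one point and $|\ell\cap\mathbb A(\chi)|=1$; (iii) $\ell\subseteq\mathbb A(\chi)$. A linear complex of $h$-subspaces is the set of $h$-subspaces whose Plücker image ($F(v_0\wedge\cdots\wedge v_h)$ for a basis $v_0,\dots,v_h$) lies in a fixed hyperplane of $\mathbb P(\bigwedge^{h+1}F^{n+1})$. For such $K$, an $(h+1)$-subspace $V$ is total if all $h$-subspaces contained in $V$ lie in $K$; otherwise there is a unique point $P$ (the pole of $V$) such that an $h$-subspace $X\subseteq V$ belongs to $K$ iff $P\in X$. The dual polarity $\downarrow K$ is the partial map on $(h+1)$-subspaces with exceptional set the total $(h+1)$-subspaces,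 sending each non-total $V$ to its pole. *)

(* Defs.v *)
From HB Require Import structures.
From mathcomp Require Import all_boot all_order all_algebra.
From Stdlib Require Import ClassicalEpsilon.

Set Implicit Arguments.
Unset Strict Implicit.
Unset Printing Implicit Defensive.

Import GRing.Theory.
Local Open Scope ring_scope.

(* Conventions: PG(n,F) is the lattice of subspaces of V = F^(n+1), modelled
   as {vspace 'rV[F]_(n.+1)}.  A projective d-subspace is a vector subspace
   of dimension d+1.  *)

Section Grass.
Variables (F : fieldType) (vT : vectType F).

Definition grass_point (k : nat) (X : {vspace vT}) : Prop := \dim X = k.+1.

Definition pencil (k : nat) (U W X : {vspace vT}) : Prop :=
  (U <= X)%VS /\ (X <= W)%VS /\ \dim X = k.+1.

Definition grass_line (k : nat) (L : {vspace vT} -> Prop) : Prop :=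
  exists U W : {vspace vT},
    \dim U = k /\ \dim W = k.+2 /\ (U <= W)%VS /\
    forall X, L X <-> pencil k U W X.

Definition partial_map := {vspace vT} -> option {vspace vT}.

Definition is_pmap (k k' : nat) (chi : partial_map) : Prop :=
  forall X Y, chi X = Some Y -> grass_point k X /\ grass_point k' Y.

Definition pimage (chi : partial_map) (L : {vspace vT} -> Prop) (Y : {vspace vT}) : Prop :=
  exists X, L X /\ chi X = Some Y.

Definition exactly_one3 (P Q R : Prop) : Prop :=
  (P /\ ~ Q /\ ~ R) \/ (~ P /\ Q /\ ~ R) \/ (~ P /\ ~ Q /\ R).

Definition linear_mapping (k k' : nat) (chi : partial_map) : Prop :=
  is_pmap k k' chi /\
  forall L, grass_line k L ->
    exactly_one3
      (grass_line k' (pimage chi L) /\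
       (forall X, L X -> chi X <> None) /\
       (forall X1 X2 Y, L X1 -> L X2 -> chi X1 = Some Y -> chi X2 = Some Y ->
          X1 = X2))
      ((exists Y, grass_point k' Y /\ forall Z, pimage chi L Z <-> Z = Y) /\
       (exists! X, L X /\ chi X = None))
      (forall X, L X -> chi X = None).

Definition total_sub (h : nat) (K : {vspace vT} -> Prop) (V : {vspace vT}) : Prop :=
  forall X, \dim X = h.+1 -> (X <= V)%VS -> K X.

Definition is_pole (h : nat) (K : {vspace vT} -> Prop) (V P : {vspace vT}) : Prop :=
  \dim P = 1%N /\ (P <= V)%VS /\
  forall X, \dim X = h.+1 -> (X <= V)%VS -> (K X <-> (P <= X)%VS).

Definition dual_polarity (h : nat) (K : {vspace vT} -> Prop) : partial_map :=
  fun V => epsilon (inhabits None)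
    (fun o => match o with
              | None => \dim V <> h.+2 \/ total_sub h K V
              | Some P => \dim V = h.+2 /\ ~ total_sub h K V /\ is_pole h K V P
              end).

End Grass.

(* Plucker embedding in standard coordinates of wedge^(h+1) F^(n+1):
   basis e_S indexed by strictly increasing maps f : 'I_(h+1) -> 'I_(n+1);
   the Plucker coordinate of the row span of M at f is det (colsub f M). *)
Definition incr (k m : nat) (f : {ffun 'I_k -> 'I_m}) : bool :=
  [forall i : 'I_k, forall j : 'I_k, (i < j)%N ==> (f i < f j)%N].

Definition plucker_form (F : fieldType) (n h : nat)
    (c : {ffun {ffun 'I_h.+1 -> 'I_n.+1} -> F}) (M : 'M[F]_(h.+1, n.+1)) : F :=
  \sum_(f : {ffun 'I_h.+1 -> 'I_n.+1} | incr f) c f * \det (colsub f M).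

Definition rowspan (F : fieldType) (m n : nat) (M : 'M[F]_(m, n)) : {vspace 'rV[F]_n} :=
  <<[seq row i M | i : 'I_m]>>%VS.

(* K is a linear complex of h-subspaces of PG(n,F): the h-subspaces whose
   Plucker image lies in the hyperplane  sum_f c_f p_f = 0  (c <> 0). *)
Definition linear_complex (F : fieldType) (n h : nat)
    (K : {vspace 'rV[F]_n.+1} -> Prop) : Prop :=
  exists c : {ffun {ffun 'I_h.+1 -> 'I_n.+1} -> F},
    (exists f, incr f && (c f != 0)) /\
    forall X, K X <-> (\dim X = h.+1 /\
                       forall M : 'M[F]_(h.+1, n.+1), rowspan M = X -> plucker_form c M = 0).

(* Main.v *)
(** By linearity of chi on the pencil (X, V0 + V), for an h-subspace X either
    every V above X in the domain is sent into X, or every V above X is in the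
    domain and is sent outside X.  The X of the first kind form K, and chi maps
    each V to the pole of K in V; so every pencil of h-subspaces is contained in
    K or meets it once, i.e. K is a geometric hyperplane of the Grassmannian.

    A geometric hyperplane is the zero set of an alternating form, by induction
    on the degree and on a coordinate subspace H + <e>: the restriction of K to H
    is given by a form phi, the h-subspaces through e by a form psi of smaller
    degree, and K itself by phi + lam (psi /\ eps) with eps the coordinate along
    e.  The scalar lam is forced for each Y with psi(Y) and phi(Y, .) nonzero;
    that it does not depend on Y is again an induction, on contractions, linking
    any two vectors through a third one that avoids two hyperplanes and two
    subspaces of codimension at least 2 (over the field with two elements lam = 1
    is the only choice). *)

Require Import Defs.
From HB Require Import structures.
From mathcomp Require Import all_boot all_order all_algebra.
From mathcomp Require Import ring zify.
From Stdlib Require Import Classical ClassicalEpsilon.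

Set Implicit Arguments.
Unset Strict Implicit.
Unset Printing Implicit Defensive.

Import GRing.Theory.
Local Open Scope ring_scope.

(** * Alternating forms and geometric hyperplanes on sequences of vectors *)

Section Forms.
Variables (F : fieldType) (V : lmodType F).
Implicit Types (f g : seq V -> F) (k : seq V -> Prop) (s t : seq V).

Definition functional (a : V -> F) :=
  forall c x y, a (c *: x + y) = c * a x + a y.

(** Only sequences of length [p] are constrained. Adjacent repetitions are enough, since
    [altform_swap] brings equal entries together. *)
Definition altform (p : nat) f :=
  (forall s1 s2, (size s1 + size s2).+1 = p ->
     functional (fun x => f (s1 ++ x :: s2))) /\
  (forall s1 s2 x, (size s1 + size s2).+2 = p -> f (s1 ++ x :: x :: s2) = 0).

(* The predicate "the span of [s] is degenerate or lies in K" for a geometric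
   hyperplane K of the Grassmannian of p-dimensional vector subspaces. *)
Definition geomhyp (p : nat) k :=
  [/\ forall s t, size s = p -> perm_eq s t -> k s -> k t,
      forall x s, (size s).+1 = p -> x \in s -> k (x :: s) &
      forall s, (size s).+1 = p ->
        exists2 a, functional a & forall x, k (x :: s) <-> a x = 0].

Section Functional.
Variables (a : V -> F) (afun : functional a).

Lemma functional0 : a 0 = 0.
Proof. by have := afun (-1) 0 0; rewrite scaler0 addr0 mulN1r addNr. Qed.

Lemma functionalD x y : a (x + y) = a x + a y.
Proof. by have := afun 1 x y; rewrite scale1r mul1r. Qed.

Lemma functionalZ c x : a (c *: x) = c * a x.
Proof. by have := afun c x 0; rewrite !addr0 functional0 addr0. Qed.

Lemma functionalN x : a (- x) = - a x.
Proof. by rewrite -scaleN1r functionalZ mulN1r. Qed.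

Lemma functionalB x y : a (x - y) = a x - a y.
Proof. by rewrite functionalD functionalN. Qed.

Lemma functional_sum (I : Type) (r : seq I) (u : I -> V) :
  a (\sum_(i <- r) u i) = \sum_(i <- r) a (u i).
Proof. by elim/big_rec2: _ => [|i y x _ <-]; rewrite ?functional0 ?functionalD. Qed.

End Functional.

Lemma altform_head p f s : altform p f -> (size s).+1 = p ->
  functional (fun x => f (x :: s)).
Proof. by move=> [lf _] sz; exact: (lf [::] s sz). Qed.

Lemma altform_contract p f z : altform p.+1 f -> altform p (fun s => f (z :: s)).
Proof.
move=> [lf af]; split=> [s1 s2 sz|s1 s2 x sz].
  by apply: (lf (z :: s1) s2); rewrite /= addSn sz.
by apply: (af (z :: s1) s2 x); rewrite /= addSn sz.
Qed.

Lemma altform_lin p f g c : altform p f -> altform p g ->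
  altform p (fun s => f s + c * g s).
Proof.
move=> [lf af] [lg ag]; split=> [s1 s2 sz b x y|s1 s2 x sz] /=.
  rewrite (lf _ _ sz) (lg _ _ sz); ring.
by rewrite af // ag // mulr0 addr0.
Qed.

Lemma altform_swap p f s1 s2 x y : altform p f ->
  (size s1 + size s2).+2 = p ->
  f (s1 ++ x :: y :: s2) = - f (s1 ++ y :: x :: s2).
Proof.
move=> [lf af] sz.
have l1 z : functional (fun x => f (s1 ++ x :: z :: s2)).
  by apply: lf => /=; rewrite addnS.
have l2 z : functional (fun x => f (s1 ++ z :: x :: s2)).
  have := lf (rcons s1 z) s2; rewrite size_rcons addSn => /(_ sz) h c u v.
  by have := h c u v; rewrite /= !cat_rcons.
have := af s1 s2 (x + y) sz.
rewrite (functionalD (l1 _)) !(functionalD (l2 _)) !af // add0r addr0.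
by move/eqP; rewrite addr_eq0 => /eqP ->.
Qed.

Lemma altform_repeat p f x s : altform p f -> (size s).+1 = p ->
  x \in s -> f (x :: s) = 0.
Proof.
elim: s p f => // y s IH p f af sz; rewrite inE => /predU1P [<-|xs].
  by case: af => _ af; apply: (af [::] s x).
rewrite (@altform_swap p f [::] s) //.
case: p sz af => // p [sz] af.
by rewrite /= (IH p (fun s => f (y :: s))) ?oppr0 //; exact: altform_contract.
Qed.

(* Permuting the arguments only changes the sign of an alternating form. *)
Lemma altform_perm0 p f s t : altform p f -> size s = p -> perm_eq s t ->
  f s = 0 -> f t = 0.
Proof.
elim: s p f t => [|x s IH] p f t af sz.
  by move=> /perm_size /esym/size0nil ->.
case: p sz af => // p [sz] af xst f0.
have xt : x \in t by rewrite -(perm_mem xst) mem_head.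
case/splitPr: xt xst => t1 t2; rewrite perm_sym (perm_catCA t1 [:: x]) perm_cons perm_sym => st.
have fx : f (x :: t1 ++ t2) = 0.
  exact: (IH p (fun s => f (x :: s)) _ (altform_contract x af) sz st f0).
have szt : (size t1 + size t2)%N = p by rewrite -sz (perm_size st) size_cat.
move: fx af szt; clear; elim: t1 f p => // y t1 IH f p fx af szt.
case: p szt af => // p [szt] af.
apply: (IH (fun s => f (y :: s)) p) => //; last exact: altform_contract.
rewrite (@altform_swap _ f [::] (t1 ++ t2) _ _ af) ?fx ?oppr0 //=.
by rewrite -szt size_cat.
Qed.

Lemma altform_geomhyp p f : altform p f -> geomhyp p (fun s => f s = 0).
Proof.
move=> af; split=> [s t sz st|x s sz xs|s sz].
- exact: (altform_perm0 af).
- exact: (altform_repeat af).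
- by exists (fun x => f (x :: s)) => //; exact: altform_head sz.
Qed.

Lemma geomhyp_contract p k z : geomhyp p.+1 k -> geomhyp p (fun s => k (z :: s)).
Proof.
move=> [pk rk lk]; split=> [s t sz st|x s sz xs|s sz].
- by apply: pk; rewrite /= ?sz // perm_cons.
- apply: (pk (x :: z :: s)); rewrite /= ?sz //; first by rewrite (perm_catCA [:: _] [:: _]).
  by apply: rk; rewrite /= ?sz // inE xs orbT.
- have [|a afun ak] := lk (z :: s); first by rewrite /= sz.
  exists a => // x; rewrite -ak.
  by split; apply: pk; rewrite /= ?sz //;
    rewrite (perm_catCA [:: _] [:: _]).
Qed.

(** With [x] among the fixed vectors, the functional of the slot of [y] vanishes at [x], because
    repetitions satisfy [k]. So each [y] can be moved along [x], one slot at a time. *)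
Lemma geomhyp_shear p k x s (c : V -> F) : geomhyp p k -> (size s).+1 = p ->
  k (x :: s) <-> k (x :: [seq y - c y *: x | y <- s]).
Proof.
elim: s p k => // y s IH p k gk sz.
case: p sz gk => // p [sz] gk; have [pk rk lk] := gk.
have swap u v r : size r = size s -> k (u :: v :: r) <-> k (v :: u :: r).
  by move=> szr; split; apply: pk; rewrite /= ?szr ?sz //;
    rewrite (perm_catCA [:: _] [:: _]).
have [|a afun ak] := lk (x :: s); first by rewrite /= sz.
have ax : a x = 0 by apply/ak/rk; rewrite ?mem_head //= sz.
have step : k (x :: y :: s) <-> k (x :: y - c y *: x :: s).
  rewrite swap // [in X in _ <-> X]swap // !ak.
  by rewrite (functionalB afun) (functionalZ afun) ax mulr0 subr0.
rewrite step /= swap // [in X in _ <-> X]swap ?size_map //.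
exact: (IH p (fun r => k (y - c y *: x :: r)) (geomhyp_contract _ gk) sz).
Qed.

Lemma geomhyp_last p k s : geomhyp p k -> (size s).+1 = p ->
  exists2 a, functional a & forall x, k (s ++ [:: x]) <-> a x = 0.
Proof.
move=> [pk _ lk] sz; have [a afun ak] := lk s sz.
exists a => // x; rewrite -ak.
by rewrite cats1; split; apply: pk; rewrite ?size_rcons ?perm_rcons // perm_sym perm_rcons.
Qed.

End Forms.

(** * The scalar joining a form on a hyperplane H to a form through [e] *)

Section Ratio.
Variables (F : fieldType) (V : lmodType F) (H : {pred V}) (e : V).
Hypothesis Hlin : forall c x y, x \in H -> y \in H -> c *: x + y \in H.
Implicit Types (f psi phi : seq V -> F) (k : seq V -> Prop) (s Y : seq V).

Let H0 x : x \in H -> 0 \in H.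
Proof. by move=> Hx; rewrite -(addNr x) -scaleN1r Hlin. Qed.

Let HZ c x : x \in H -> c *: x \in H.
Proof. by move=> Hx; rewrite -[_ *: _]addr0 Hlin // (H0 Hx). Qed.

Let HD x y : x \in H -> y \in H -> x + y \in H.
Proof. by move=> Hx Hy; rewrite -[x]scale1r Hlin. Qed.

Let HB x y : x \in H -> y \in H -> x - y \in H.
Proof. by move=> Hx Hy; rewrite HD // -scaleN1r HZ. Qed.

Definition nonzero_on p f := exists s, [/\ size s = p, all [in H] s & f s <> 0].

Lemma not_nonzero_on p f s : ~ nonzero_on p f -> size s = p -> all [in H] s ->
  f s = 0.
Proof. by move=> nf sz Hs; apply: NNPP => fs; apply: nf; exists s. Qed.

(** A vector space is not the union of two proper subspaces: one of [u], [v], [u + v] lies outside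
    both kernels. *)
Lemma common_nonzero (a b : V -> F) u v : functional a -> functional b ->
  u \in H -> v \in H -> a u <> 0 -> b v <> 0 ->
  exists x, [/\ x \in H, a x <> 0 & b x <> 0].
Proof.
move=> la lb Hu Hv au bv.
have [bu|/eqP bu] := eqVneq (b u) 0; last by exists u.
have [av|/eqP av] := eqVneq (a v) 0; last by exists v.
exists (u + v); split; first exact: HD.
  by rewrite functionalD // av addr0.
by rewrite functionalD // bu add0r.
Qed.

Lemma nonzero_on_contract p q psi phi : altform p.+1 psi -> altform q.+1 phi ->
  nonzero_on p.+1 psi -> nonzero_on q.+1 phi ->
  exists x, [/\ x \in H, nonzero_on p (fun s => psi (x :: s)) &
                nonzero_on q (fun s => phi (x :: s))].
Proof.
move=> apsi aphi [[|y s] [//= [szs] /andP [Hy Hs] fy]].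
move=> [[|z t] [//= [szt] /andP [Hz Ht] fz]].
have lpsi := altform_head apsi (congr1 S szs).
have lphi := altform_head aphi (congr1 S szt).
have [x [Hx ax bx]] := common_nonzero lpsi lphi Hy Hz fy fz.
by exists x; split=> //; [exists s|exists t].
Qed.

(** Contract both forms repeatedly by a vector that keeps both nonzero. The resulting [Y], [x] is a
    place where the scalar is determined. *)
Lemma common_nonzero_on m psi phi : altform m psi -> altform m.+1 phi ->
  nonzero_on m psi -> nonzero_on m.+1 phi ->
  exists Y x, [/\ size Y = m, all [in H] Y, x \in H, psi Y <> 0 &
                  phi (Y ++ [:: x]) <> 0].
Proof.
elim: m psi phi => [|m IH] psi phi apsi aphi npsi nphi.
  have [[|? ?] [//= _ _ pn]] := npsi.
  have [[|x [|? ?]] [//= _ /andP [Hx _] px]] := nphi.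
  by exists [::], x.
have [z [Hz nz1 nz2]] := nonzero_on_contract apsi aphi npsi nphi.
have [Y [x [szY HY Hx pY px]]] :=
  IH _ _ (altform_contract z apsi) (altform_contract z aphi) nz1 nz2.
by exists (z :: Y), x; rewrite /= szY Hz HY.
Qed.

Lemma altform_last m phi Y : altform m.+1 phi -> size Y = m ->
  functional (fun x => phi (Y ++ [:: x])).
Proof. by move=> [lf _] szY; apply: (lf Y [::]); rewrite szY addn0. Qed.

(* [phi + lam * psi] describes k on the affine hyperplane e + H. *)
Definition ratio m k psi phi (lam : F) := forall Y x,
  size Y = m -> all [in H] Y -> x \in H ->
  (k (Y ++ [:: e + x]) <-> phi (Y ++ [:: x]) + lam * psi Y = 0).

(** Where [psi Y] and [phi (Y, x)] are nonzero, a multiple of [x] solves the equation for [lam]; it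
    then solves the one for [mu] too. *)
Lemma ratio_unique m k psi phi lam mu : altform m psi -> altform m.+1 phi ->
  nonzero_on m psi -> nonzero_on m.+1 phi ->
  ratio m k psi phi lam -> ratio m k psi phi mu -> lam = mu.
Proof.
move=> apsi aphi npsi nphi rl rm.
have [Y [x [szY HY Hx /eqP pY /eqP px]]] := common_nonzero_on apsi aphi npsi nphi.
pose c := - (lam * psi Y) / phi (Y ++ [:: x]).
have pc : phi (Y ++ [:: c *: x]) = - (lam * psi Y).
  by rewrite (functionalZ (altform_last aphi szY)) divfK.
have /(rl Y _ szY HY (HZ c Hx)) : phi (Y ++ [:: c *: x]) + lam * psi Y = 0.
  by rewrite pc addNr.
move/(rm Y _ szY HY (HZ c Hx))/eqP.
by rewrite pc addrC subr_eq0 => /eqP /(mulIf pY).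
Qed.

Section Agree.
Variables (m : nat) (k : seq V -> Prop) (psi phi : seq V -> F).

(** The data of the inductive step: [psi] describes the members of K through [e], [phi] those inside
    H. Each is determined only up to a scalar, whence the need for [lam]. *)
Definition agree :=
  (forall Y, size Y = m -> all [in H] Y -> (k (Y ++ [:: e]) <-> psi Y = 0)) /\
  (forall s, size s = m.+1 -> all [in H] s -> (k s <-> phi s = 0)).

(** If [phi] vanishes on H, the condition at [e + x] reduces to the one at [e]; if [psi] does, it
    reduces to the one at [x]. Either way any nonzero scalar fits. *)
Lemma ratio_degenerate lam : geomhyp m.+1 k -> agree -> lam != 0 ->
  ~ (nonzero_on m psi /\ nonzero_on m.+1 phi) -> ratio m k psi phi lam.
Proof.
move=> gk [kpsi kphi] lam0 ndeg Y x szY HY Hx.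
have [a la ka] := geomhyp_last gk (congr1 S szY).
have := kpsi Y szY HY; have := kphi (Y ++ [:: x]).
rewrite size_cat szY addn1 all_cat /= HY Hx => /(_ erefl erefl) kx ke.
rewrite ka functionalD //; rewrite !ka in kx ke.
have [npsi|npsi] := classic (nonzero_on m psi).
  have px : phi (Y ++ [:: x]) = 0.
    apply: (@not_nonzero_on m.+1); last by rewrite all_cat /= HY Hx.
      by move=> nphi; apply: ndeg.
    by rewrite size_cat szY addn1.
  have [_ /(_ px) ax] := kx; rewrite px ax addr0 add0r ke.
  by split=> [->|/eqP]; rewrite ?mulr0 // mulf_eq0 (negPf lam0) => /eqP.
have pY := not_nonzero_on npsi szY HY.
by have [_ /(_ pY) ->] := ke; rewrite pY mulr0 addr0 add0r.
Qed.

End Agree.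

Lemma agree_contract m k psi phi z : z \in H -> agree m.+1 k psi phi ->
  agree m (fun s => k (z :: s)) (fun s => psi (z :: s)) (fun s => phi (z :: s)).
Proof.
move=> Hz [kpsi kphi]; split=> [Y szY HY|s szs Hs].
  by apply: (kpsi (z :: Y)); rewrite /= ?szY // Hz.
by apply: (kphi (z :: s)); rewrite /= ?szs // Hz.
Qed.

Lemma functionals_dependent (a b : V -> F) : functional a -> functional b ->
  (exists2 u, u \in H & a u <> 0) ->
  (exists c, forall x, x \in H -> b x = c * a x) \/
  (forall u v, exists x, [/\ x \in H, a x = u & b x = v]).
Proof.
move=> la lb [u Hu /eqP au].
pose c := b u / a u.
have [dep|ind] := classic (forall x, x \in H -> b x = c * a x).
  by left; exists c.
have [x Hx bx] : exists2 x, x \in H & b x <> c * a x.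
  by apply: NNPP => none; apply: ind => x Hx; apply: NNPP => bx; apply: none; exists x.
(* [y] lies in the kernel of [a] but not in that of [b], so the pair of functionals is triangular on
   [u], [y] and takes any two values. *)
right=> r t; pose y := x - (a x / a u) *: u.
have Hy : y \in H by rewrite HB ?HZ.
have ay : a y = 0 by rewrite functionalB // functionalZ // divfK // subrr.
have by0 : b y != 0.
  apply/eqP; rewrite functionalB // functionalZ // => /eqP; rewrite subr_eq0 => /eqP bE.
  by apply: bx; rewrite bE /c mulrAC [RHS]mulrAC [a x * _]mulrC.
exists ((r / a u) *: u + ((t - r / a u * b u) / b y) *: y); split.
- by rewrite HD ?HZ.
- by rewrite functionalD // !functionalZ // ay mulr0 addr0 divfK.
- by rewrite functionalD // !functionalZ // divfK // addrC subrK.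
Qed.

(** * Comparison of scalars for a form of degree 2 *)

Section LinkPoints.
Variables (k : seq V -> Prop) (psi phi : seq V -> F).
Hypotheses (gk : geomhyp 2 k) (apsi : altform 1 psi) (aphi : altform 2 phi).
Hypothesis ag : agree 1 k psi phi.

Let lpsi : functional (fun z => psi [:: z]).
Proof. exact: (@altform_head _ _ 1 psi [::]). Qed.
Let lphi1 x : functional (fun z => phi [:: z; x]).
Proof. exact: (@altform_head _ _ 2 phi [:: x]). Qed.
Let lphi2 x : functional (fun z => phi [:: x; z]).
Proof. exact: (@altform_last 1 phi [:: x]). Qed.

(** This is [ratio] of degree 0 for the contractions by [z], with the empty sequence filled in. *)
Definition pratio z lam := forall x, x \in H ->
  (k [:: z; e + x] <-> phi [:: z; x] + lam * psi [:: z] = 0).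

(** A combination [w] of [y] and [z] with [psi] zero satisfies [k] together with [e + x] and with
    [e], hence with [x]. Then [phi] vanishes at [w], [x], and expanding it leaves [lam - mu] times a
    nonzero factor. *)
Lemma pratio_common y z x lam mu : y \in H -> z \in H -> x \in H ->
  psi [:: y] <> 0 -> psi [:: z] <> 0 ->
  pratio y lam -> pratio z mu ->
  phi [:: y; x] = - (lam * psi [:: y]) -> phi [:: z; x] = - (mu * psi [:: z]) ->
  lam = mu.
Proof.
move=> Hy Hz Hx /eqP py /eqP pz ry rz fy fz.
have ky : k [:: y; e + x] by apply/ry; rewrite // fy addNr.
have kz : k [:: z; e + x] by apply/rz; rewrite // fz addNr.
pose w := psi [:: z] *: y - psi [:: y] *: z.
have Hw : w \in H by rewrite HB ?HZ.
have [kpsi kphi] := ag.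
have [_ _ lk] := gk; have [a la ak] := lk [:: e + x] erefl.
have kw : k [:: w; e + x].
  apply/ak; rewrite functionalB // !functionalZ //.
  by have /ak -> := ky; have /ak -> := kz; rewrite !mulr0 subrr.
have ke : k [:: w; e].
  apply/(kpsi [:: w]); rewrite //= ?Hw // (functionalB lpsi) !(functionalZ lpsi).
  by rewrite mulrC subrr.
have [b lb bk] := @geomhyp_last _ _ 2 k [:: w] gk erefl.
have /bk : k [:: w; e + x] by [].
have /bk be : k ([:: w] ++ [:: e]) by [].
rewrite functionalD // be add0r => /bk /kphi; rewrite /= Hw Hx => /(_ erefl erefl).
rewrite (functionalB (lphi1 x)) !(functionalZ (lphi1 x)) fy fz => E.
have : (lam - mu) * (psi [:: y] * psi [:: z]) == 0.
  by rewrite -oppr_eq0 -E; apply/eqP; ring.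
by rewrite mulf_eq0 (negPf (mulf_neq0 py pz)) orbF subr_eq0 => /eqP.
Qed.

Hypothesis rat : forall z, z \in H -> exists lam, pratio z lam.

(** If [phi (y, .)] and [phi (z, .)] are independent, an [x] as in [pratio_common] exists. If they
    are proportional, both vanish at [y]; a third [w] with [psi w] and [phi (w, y)] nonzero is then
    independent of each and links them. *)
Lemma pratio_link y z lam mu : y \in H -> z \in H ->
  psi [:: y] <> 0 -> psi [:: z] <> 0 ->
  (exists2 x, x \in H & phi [:: y; x] <> 0) ->
  (exists2 x, x \in H & phi [:: z; x] <> 0) ->
  pratio y lam -> pratio z mu -> lam = mu.
Proof.
move=> Hy Hz py pz ny nz ry rz.
have indep u v lu lv : u \in H -> v \in H -> psi [:: u] <> 0 -> psi [:: v] <> 0 ->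
    (exists2 x, x \in H & phi [:: u; x] <> 0) -> pratio u lu -> pratio v lv ->
    (forall c, exists2 x, x \in H & phi [:: v; x] <> c * phi [:: u; x]) -> lu = lv.
  move=> Hu Hv pu pv nu ru rv ind.
  have [[c dep]|sol] := functionals_dependent (lphi2 u) (lphi2 v) nu.
    by have [x Hx] := ind c; rewrite dep.
  have [x [Hx fu fv]] := sol (- (lu * psi [:: u])) (- (lv * psi [:: v])).
  exact: (pratio_common Hu Hv Hx pu pv ru rv).
have [[c dep]|sol] := functionals_dependent (lphi2 y) (lphi2 z) ny; last first.
  have [x [Hx fu fv]] := sol (- (lam * psi [:: y])) (- (mu * psi [:: z])).
  exact: (pratio_common Hy Hz Hx py pz ry rz).
have pyy : phi [:: y; y] = 0 by case: aphi => _ /(_ [::] [::] y erefl).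
have pzy : phi [:: z; y] = 0 by rewrite dep // pyy mulr0.
have [x0 Hx0 fx0] := ny.
have fx0' : phi [:: x0; y] <> 0.
  move=> f0; apply: fx0; rewrite (@altform_swap _ _ 2 phi [::] [::]) //= f0 oppr0 //.
have [w [Hw pw fw]] := common_nonzero lpsi (lphi1 y) Hy Hx0 py fx0'.
have [nu rw] := rat Hw.
transitivity nu.
  apply: (indep y w) => // d; exists y => //.
  by rewrite pyy mulr0.
apply/esym/(indep z w) => // d; exists y => //.
by rewrite pzy mulr0.
Qed.

End LinkPoints.

(** * Vectors avoiding two kernels and two radicals *)

Section Cover.
Variables (q : nat) (a b : V -> F).
Hypotheses (la : functional a) (lb : functional b).

Let rad f x := forall s, size s = q.+1 -> all [in H] s -> f (x :: s) = 0.

Let rad_lin f c x y : altform q.+2 f -> rad f x -> rad f y -> rad f (c *: x + y).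
Proof.
move=> af rx ry s szs Hs.
by rewrite (altform_head af (congr1 S szs)) rx // ry // mulr0 addr0.
Qed.

(* The radical of a nonzero alternating form of degree at least 2 has
   codimension at least 2, so it cannot contain a hyperplane. *)
Let rad_small f w : altform q.+2 f -> nonzero_on q.+2 f -> w \in H ->
  a w <> 0 ->
  exists c, [/\ c \in H, a c = 0, b c = 0 & ~ rad f (w + c)].
Proof.
move=> af [[|x [|y s]] [//= [szs] /and3P [Hx Hy Hs] fxy]] Hw /eqP aw.
apply: NNPP => none.
have radC c : c \in H -> a c = 0 -> b c = 0 -> rad f (w + c).
  by move=> Hc ac bc; apply: NNPP => nr; apply: none; exists c.
have rw : rad f w by rewrite -[w]addr0; apply: radC; rewrite ?functional0 ?(H0 Hw).
have rC c : c \in H -> a c = 0 -> b c = 0 -> rad f c.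
  move=> Hc ac bc; rewrite (_ : c = (-1) *: w + (w + c)).
    by apply: rad_lin => //; apply: radC.
  by rewrite scaleN1r addKr.
have swap u v : f (u :: v :: s) = - f (v :: u :: s).
  by apply: (@altform_swap _ _ q.+2 f [::] s); rewrite //= szs.
have lf u : functional (fun x => f (x :: u :: s)).
  by apply: altform_head af _; rewrite /= szs.
(* Inside the kernel of [a], the part killed by [b] lies in the radical and has codimension at most
   one. So [v] is a multiple of [u] up to the radical, and [f] is alternating. *)
have f0 u v : u \in H -> v \in H -> a u = 0 -> a v = 0 -> f (u :: v :: s) = 0.
  move=> Hu Hv au av.
  have [bu|bu] := eqVneq (b u) 0; first by apply: rC; rewrite /= ?szs ?Hv.
  have -> : v = (b v / b u) *: u + (v - (b v / b u) *: u) by rewrite addrC subrK.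
  rewrite swap (lf u).
  case: (af) => _ /(_ [::] s u); rewrite /= szs => -> //.
  rewrite mulr0 add0r.
  rewrite rC ?oppr0 //= ?szs ?Hu //; first by rewrite HB ?HZ.
    by rewrite functionalB // functionalZ // au av mulr0 subr0.
  by rewrite functionalB // functionalZ // divfK // subrr.
(* As [w] is in the radical, any argument can be moved along [w] into the kernel of [a], where [f0]
   applies. *)
have red u v : v \in H -> f (u :: v :: s) = f (u - (a u / a w) *: w :: v :: s).
  move=> Hv; rewrite (functionalB (lf v)) (functionalZ (lf v)) rw ?mulr0 ?subr0 //=.
    by rewrite szs.
  by rewrite Hv.
apply: fxy; rewrite red // swap red; last by rewrite HB ?HZ.
rewrite f0 ?oppr0 ?HB ?HZ //.
  by rewrite functionalB // functionalZ // divfK // subrr.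
by rewrite functionalB // functionalZ // divfK // subrr.
Qed.

(* Two hyperplanes and two subspaces of codimension at least 2 cannot cover H
   when the field has at least three elements: otherwise a coset of the
   intersection of the hyperplanes would be covered by the two subspaces,
   though neither contains it, and its line through one point of each would
   have at most two points. *)
Lemma avoid_four f g u v (t : F) : altform q.+2 f -> altform q.+2 g ->
  nonzero_on q.+2 f -> nonzero_on q.+2 g ->
  u \in H -> a u <> 0 -> v \in H -> b v <> 0 -> t != 0 -> t != 1 ->
  exists w, [/\ w \in H, a w <> 0, b w <> 0,
                nonzero_on q.+1 (fun s => f (w :: s)) &
                nonzero_on q.+1 (fun s => g (w :: s))].
Proof.
move=> af ag nf ng Hu au Hv bv t0 t1.
have [w [Hw aw bw]] := common_nonzero la lb Hu Hv au bv.
apply: NNPP => none.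
have cov c : c \in H -> a c = 0 -> b c = 0 -> rad f (w + c) \/ rad g (w + c).
  move=> Hc ac bc; apply: NNPP => /not_or_and [rf rg]; apply: none.
  have nz h : ~ rad h (w + c) -> nonzero_on q.+1 (fun s => h (w + c :: s)).
    move=> nr; apply: NNPP => nn; apply: nr => s szs Hs.
    exact: (not_nonzero_on nn szs Hs).
  exists (w + c); split; [exact: HD| | |exact: nz|exact: nz];
    by rewrite functionalD // ?ac ?bc addr0.
have [c [Hc ac bc nrf]] := rad_small af nf Hw aw.
have [d [Hd ad bd nrg]] := rad_small ag ng Hw aw.
have rgc : rad g (w + c) by case: (cov c Hc ac bc).
have rfd : rad f (w + d) by case: (cov d Hd ad bd).
have [|||r|r] := cov (d + t *: (c - d)).
- by rewrite HD ?HZ ?HB.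
- by rewrite functionalD // functionalZ // functionalB // ac ad subrr mulr0 addr0.
- by rewrite functionalD // functionalZ // functionalB // bc bd subrr mulr0 addr0.
- apply: nrf => s szs Hs; have lf := altform_head af (congr1 S szs).
  have := r s szs Hs; have := rfd s szs Hs.
  rewrite !(functionalD lf) (functionalZ lf) (functionalB lf) => e1.
  rewrite addrA e1 add0r => /eqP; rewrite mulf_eq0 (negPf t0) subr_eq0 => /eqP ->.
  exact: e1.
- apply: nrg => s szs Hs; have lg := altform_head ag (congr1 S szs).
  have := r s szs Hs; have := rgc s szs Hs.
  rewrite !(functionalD lg) (functionalZ lg) (functionalB lg) => /eqP.
  rewrite addrC addr_eq0 => /eqP -> e1.
  apply/eqP; have : (1 - t) * (g (w :: s) + g (d :: s)) == 0.
    by rewrite -e1; apply/eqP; ring.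
  by rewrite mulf_eq0 subr_eq0 eq_sym (negPf t1).
Qed.

End Cover.
(** For [x] equal to [y] or [z], the scalars of [x] and of the third vector [w] both serve the
    double contraction by [x] and [w], so [ratio_unique] identifies them. *)
Lemma ratio_link q k psi phi y z lam mu :
  altform q.+2 psi -> altform q.+3 phi -> geomhyp q.+3 k ->
  agree q.+2 k psi phi ->
  (forall w, w \in H -> exists2 nu, nu != 0 &
    ratio q.+1 (fun s => k (w :: s)) (fun s => psi (w :: s))
      (fun s => phi (w :: s)) nu) ->
  lam != 0 -> mu != 0 -> y \in H -> z \in H ->
  nonzero_on q.+1 (fun s => psi (y :: s)) -> nonzero_on q.+2 (fun s => phi (y :: s)) ->
  nonzero_on q.+1 (fun s => psi (z :: s)) -> nonzero_on q.+2 (fun s => phi (z :: s)) ->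
  ratio q.+1 (fun s => k (y :: s)) (fun s => psi (y :: s)) (fun s => phi (y :: s)) lam ->
  ratio q.+1 (fun s => k (z :: s)) (fun s => psi (z :: s)) (fun s => phi (z :: s)) mu ->
  lam = mu.
Proof.
move=> apsi aphi gk ag rat lam0 mu0 Hy Hz npy nfy npz nfz ry rz.
have [[t /andP [t0 t1]]|two] := classic (exists t : F, (t != 0) && (t != 1)); last first.
  have one (c : F) : c != 0 -> c = 1.
    by move=> c0; apply/eqP; apply: NNPP => /negP c1; apply: two; exists c; rewrite c0.
  by rewrite (one lam) // (one mu).
have [[|u r] [//= [szr] /andP [Hu Hr] pu]] := npy.
have [[|v r'] [//= [szr'] /andP [Hv Hr'] pv]] := npz.
have slot x rr : size rr = q -> functional (fun w => psi (x :: w :: rr)).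
  by move=> szrr; have := altform_head (altform_contract x apsi) (congr1 S szrr).
(* The hyperplanes to avoid are the kernels of [psi (y, ., r)] and [psi (z, ., r')]; the two small
   subspaces are the radicals of the contractions of [phi] by [y] and [z]. *)
have [w [Hw aw bw nfyw nfzw]] :=
  avoid_four (slot y r szr) (slot z r' szr') (altform_contract y aphi)
    (altform_contract z aphi) nfy nfz Hu pu Hv pv t0 t1.
have [nu nu0 rw] := rat w Hw.
have linked x la : x \in H -> nonzero_on q (fun s => psi (x :: w :: s)) ->
    nonzero_on q.+1 (fun s => phi (x :: w :: s)) ->
    ratio q.+1 (fun s => k (x :: s)) (fun s => psi (x :: s)) (fun s => phi (x :: s)) la ->
    la = nu.
  move=> Hx npx nfx rx.
  apply: (@ratio_unique q (fun s => k (x :: w :: s)) (fun s => psi (x :: w :: s))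
    (fun s => phi (x :: w :: s))) => //.
  - exact: (altform_contract w (altform_contract x apsi)).
  - exact: (altform_contract w (altform_contract x aphi)).
  - move=> Y c szY HY Hc; apply: (rx (w :: Y) c); rewrite /= ?szY ?Hw //.
  (* The scalar of [w] concerns the order [w], [x]. Exchanging them negates both forms, so the zeros
     of the sum are unchanged. *)
  - move=> Y c szY HY Hc; have := rw (x :: Y) c; rewrite /= szY Hx => /(_ erefl HY Hc).
    rewrite (@altform_swap _ _ _ phi [::] _ _ _ aphi) /= ?size_cat ?szY ?addn1 //.
    rewrite (@altform_swap _ _ _ psi [::] _ _ _ apsi) /= ?szY //.
    rewrite mulrN -opprD => [[k1 k2]].
    have [pk _ _] := gk.
    have swk u1 u2 rr : size rr = q.+1 -> k (u1 :: u2 :: rr) -> k (u2 :: u1 :: rr).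
      by move=> szrr; apply: pk; rewrite /= ?szrr // (perm_catCA [:: _] [:: _]).
    have szc (x' : V) : size (Y ++ [:: x']) = q.+1 by rewrite size_cat szY addn1.
    split=> [/(swk _ _ _ (szc _)) /k1 /eqP|f0].
      by rewrite oppr_eq0 => /eqP.
    by apply: (swk _ _ _ (szc _)); apply: k2; rewrite f0 oppr0.
transitivity nu; first by apply: (linked y); rewrite //; exists r.
by apply/esym; apply: (linked z); rewrite //; exists r'.
Qed.

(** Here [k] is the kernel of one functional [a], and on H the functional [phi] has the same kernel,
    so [a = d * phi] there. Factoring [d] out of [a e + d * phi c] gives the witness. *)
Lemma ratio0 k psi phi : geomhyp 1 k -> altform 1 phi -> agree 0 k psi phi ->
  exists2 lam, lam != 0 & ratio 0 k psi phi lam.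
Proof.
move=> gk aphi ag.
have [[npsi nphi]|ndeg] := classic (nonzero_on 0 psi /\ nonzero_on 1 phi); last first.
  by exists 1; [exact: oner_neq0|apply: ratio_degenerate ag _ ndeg => //; exact: oner_neq0].
have [kpsi kphi] := ag.
have [[|? ?] [//= _ _ /eqP p0]] := npsi.
have [[|x [|? ?]] [//= _ /andP [Hx _] /eqP fx]] := nphi.
have [a la ka] := @geomhyp_last _ _ 1 k [::] gk erefl.
have lphi := @altform_last 0 phi [::] aphi erefl.
have kx c : c \in H -> a c = 0 <-> phi [:: c] = 0.
  by move=> Hc; rewrite -ka; apply: kphi; rewrite //= Hc.
have ax : a x != 0 by apply/eqP => /(kx _ Hx) /eqP; rewrite (negPf fx).
have ae : a e != 0.
  apply/eqP => ae; move/eqP: p0; apply; apply: (kpsi [::] erefl erefl).1.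
  exact/ka.
exists (a e / (a x / phi [:: x] * psi [::])).
  by rewrite !mulf_neq0 ?invr_eq0 ?mulf_neq0 ?invr_eq0.
move=> [|? ?] c //= _ _ Hc; rewrite (ka (e + c)) functionalD //.
have aE : a c = a x / phi [:: x] * phi [:: c].
  have : phi [:: c - (phi [:: c] / phi [:: x]) *: x] = 0.
    by rewrite (functionalB lphi) (functionalZ lphi) divfK // subrr.
  move/kx; rewrite functionalB // functionalZ // => /(_ (HB Hc (HZ _ Hx))) /eqP.
  rewrite subr_eq0 => /eqP ->; ring.
have d0 : a x / phi [:: x] != 0 by rewrite mulf_neq0 ?invr_eq0.
rewrite aE; set d := a x / _ in d0 *.
have -> : a e + d * phi [:: c] = d * (phi [:: c] + a e / (d * psi [::]) * psi [::]).
  by field; rewrite d0 p0.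
by split=> [/eqP|->]; rewrite ?mulr0 // mulf_eq0 (negPf d0) => /eqP.
Qed.

(** A vector [y] with both contractions nonzero fixes the scalar. Another [z] accepts it by
    [ratio_degenerate] if one of its contractions vanishes on H, and is linked to [y] otherwise. *)
Lemma exists_ratio m k psi phi : geomhyp m.+1 k -> altform m psi ->
  altform m.+1 phi -> agree m k psi phi ->
  exists2 lam, lam != 0 & ratio m k psi phi lam.
Proof.
elim: m k psi phi => [|m IH] k psi phi gk apsi aphi ag; first exact: ratio0.
have [[npsi nphi]|ndeg] := classic (nonzero_on m.+1 psi /\ nonzero_on m.+2 phi); last first.
  by exists 1; [exact: oner_neq0|apply: ratio_degenerate ag _ ndeg => //; exact: oner_neq0].
have rat z : z \in H -> exists2 nu, nu != 0 &
    ratio m (fun s => k (z :: s)) (fun s => psi (z :: s)) (fun s => phi (z :: s)) nu.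
  move=> Hz; apply: IH; [exact: geomhyp_contract|exact: altform_contract|
    exact: altform_contract|exact: agree_contract].
have [y [Hy npy nfy]] := nonzero_on_contract apsi aphi npsi nphi.
have [lam lam0 ry] := rat y Hy; exists lam => // -[//|z Y] x [szY] /= /andP [Hz HY] Hx.
have [[npz nfz]|nz] := classic (nonzero_on m (fun s => psi (z :: s)) /\
    nonzero_on m.+1 (fun s => phi (z :: s))); last first.
  apply: (ratio_degenerate (geomhyp_contract z gk) (agree_contract Hz ag) lam0 nz) => //.
have [mu mu0 rz] := rat z Hz.
suff -> : lam = mu by exact: rz.
(* In the lowest case the contraction of [phi] by [y] is a functional, whose radical has codimension
   one only; there [pratio_link] replaces the covering argument. *)
case: m gk apsi aphi ag npsi nphi rat npy nfy ry npz nfz rz szY {IH} => [|m] gk apsi aphi ag npsi nphi rat npy nfy ry npz nfz rz szY.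
  have pr w nu : ratio 0 (fun s => k (w :: s)) (fun s => psi (w :: s))
      (fun s => phi (w :: s)) nu -> pratio k psi phi w nu.
    by move=> rw c Hc; apply: (rw [::]).
  have nz1 f w : nonzero_on 1 (fun s => f (w :: s)) -> exists2 c, c \in H & f [:: w; c] <> 0.
    by move=> [[|c [|? ?]] [//= _ /andP [Hc _] fc]]; exists c.
  have nz0 f w : nonzero_on 0 (fun s => f (w :: s)) -> f [:: w] <> 0.
    by move=> [[|? ?] [//= _ _ fc]].
  apply: (@pratio_link k psi phi gk apsi aphi ag _ y z) => //; try by [apply: nz1|apply: nz0|apply: pr].
  by move=> w Hw; have [nu _ /pr rw] := rat w Hw; exists nu.
exact: (ratio_link apsi aphi gk ag rat lam0 mu0 Hy Hz npy nfy npz nfz ry rz).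
Qed.

End Ratio.

(** * Exterior product of an alternating form with a functional *)

Section Wedge.
Variables (F : fieldType) (V : lmodType F) (eps : V -> F).
Hypothesis leps : functional eps.
Implicit Types (psi f g h : seq V -> F) (s t : seq V).

(** The exterior product of [psi] and [eps], expanded over the argument given to [eps]. The sign
    counts the arguments after it, so that [eps] in the last slot gets sign +1. *)
Fixpoint wedge psi s : F :=
  if s is x :: t
  then wedge (fun r => psi (x :: r)) t + (-1) ^+ size t * (eps x * psi t)
  else 0.

Lemma wedge_lin f g h c s :
  (forall t, (size t).+1 = size s -> h t = c * f t + g t) ->
  wedge h s = c * wedge f s + wedge g s.
Proof.
elim: s f g h => [|x s IH] f g h hE /=; first by rewrite mulr0 addr0.
rewrite (IH (fun t => f (x :: t)) (fun t => g (x :: t))); last first.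
  by move=> t szt; rewrite hE //= szt.
rewrite hE //; ring.
Qed.

Lemma wedge_zero h s : (forall t, (size t).+1 = size s -> h t = 0) ->
  wedge h s = 0.
Proof.
elim: s h => //= x s IH h hE; rewrite IH ?hE ?mulr0 ?addr0 // => t szt.
by rewrite hE //= szt.
Qed.

Lemma wedge_altform m psi : altform m psi -> altform m.+1 (wedge psi).
Proof.
move=> apsi; split=> [s1|s1].
  elim: s1 m psi apsi => [|z s1 IH] m psi apsi s2 /= sz c x y /=.
    rewrite (@wedge_lin (fun t => psi (x :: t)) (fun t => psi (y :: t)) _ c); last first.
      move=> t szt; apply: (altform_head apsi).
      by case: sz => <-; rewrite szt.
    rewrite leps; ring.
  case: sz; case: m apsi => // m apsi [sz].
  rewrite (IH _ _ (altform_contract z apsi) s2 _ c x y) ?addSn ?sz //.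
  have := apsi.1 s1 s2 _ c x y; rewrite sz => -> //.
  rewrite !size_cat /=; ring.
elim: s1 m psi apsi => [|z s1 IH] m psi apsi s2 x /=.
  case: m apsi => // m apsi [sz].
  (* The two terms giving one copy of [x] to [eps] have opposite signs; in all others [psi] sees
     both copies. *)
  rewrite wedge_zero; first by rewrite exprS; ring.
  move=> t szt; have := apsi.2 [::] t x; rewrite /= => -> //.
  by rewrite -sz add0n -szt.
case: m apsi => [|[|m]] apsi; rewrite ?addSn // => -[sz].
rewrite (IH _ _ (altform_contract z apsi)) ?sz //.
by rewrite apsi.2 ?sz // !mulr0 addr0.
Qed.

Lemma wedge_vanish psi s : all [pred x | eps x == 0] s -> wedge psi s = 0.
Proof.
elim: s psi => //= x s IH psi /andP [/eqP -> es].
by rewrite IH // mul0r mulr0 addr0.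
Qed.

Lemma wedge_last psi Y x : all [pred x | eps x == 0] Y ->
  wedge psi (Y ++ [:: x]) = eps x * psi Y.
Proof.
elim: Y psi => [|y Y IH] psi /=; first by rewrite expr0 mul1r add0r.
by case/andP=> /eqP -> eY; rewrite IH // mul0r mulr0 addr0.
Qed.

End Wedge.

Section Reduce.
Variables (F : fieldType) (V : lmodType F).

Lemma altform_comp p (f : seq V -> F) (T : V -> V) :
  (forall c (x y : V), T (c *: x + y) = c *: T x + T y) -> altform p f ->
  altform p (fun s => f (map T s)).
Proof.
move=> lT [lf af]; split=> [s1 s2 sz c x y|s1 s2 x sz].
  by rewrite !map_cat /= lT lf ?size_map.
by rewrite map_cat /= af ?size_map.
Qed.

(** Shearing clears the other vectors along [x], and scaling [x] keeps the zeros of its functional.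
    A sequence with [x] outside H thus takes the shape treated by [ratio]. *)
Lemma geomhyp_reduce p (k : seq V -> Prop) (b : V -> F) c (x : V) (s : seq V) :
  geomhyp p.+1 k -> size s = p -> c != 0 ->
  k (x :: s) <-> k ([seq y - b y *: x | y <- s] ++ [:: c *: x]).
Proof.
move=> gk sz c0; rewrite (geomhyp_shear x b gk (congr1 S sz)).
set t := map _ s; have szt : size t = p by rewrite size_map.
have [a la ka] := geomhyp_last gk (congr1 S szt).
have [pk _ _] := gk.
have -> : k (x :: t) <-> k (t ++ [:: x]).
  by rewrite cats1; split; apply: pk; rewrite ?size_rcons /= ?szt // ?perm_rcons // perm_sym perm_rcons.
rewrite !ka functionalZ //; split=> [->|/eqP]; first by rewrite mulr0.
by rewrite mulf_eq0 (negPf c0) => /eqP.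
Qed.

End Reduce.

(** * Every geometric hyperplane is the zero set of an alternating form *)

Section Existence.
Variables (F : fieldType) (N : nat).
Implicit Types (i : nat) (x y : 'rV[F]_N) (s : seq 'rV[F]_N).

Definition lowcoord (i : nat) : {pred 'rV[F]_N} :=
  [pred x : 'rV[F]_N | [forall j : 'I_N, (i <= j)%N ==> (x 0 j == 0)]].

Definition trunc (i : nat) (x : 'rV[F]_N) : 'rV[F]_N :=
  \row_j (if (j < i)%N then x 0 j else 0).

Lemma lowcoordP i x :
  reflect (forall j : 'I_N, (i <= j)%N -> x 0 j = 0) (x \in lowcoord i).
Proof.
apply: (iffP forallP) => h j; first by move=> ij; apply/eqP; have /implyP := h j; apply.
by apply/implyP => ij; rewrite h.
Qed.

Lemma lowcoord_lin i c x y : x \in lowcoord i -> y \in lowcoord i ->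
  c *: x + y \in lowcoord i.
Proof.
move=> /lowcoordP hx /lowcoordP hy; apply/lowcoordP => j ij.
by rewrite !mxE hx // hy // mulr0 addr0.
Qed.

Lemma trunc_lin i c x y : trunc i (c *: x + y) = c *: trunc i x + trunc i y.
Proof. by apply/rowP => j; rewrite !mxE; case: ifP; rewrite // mulr0 addr0. Qed.

Lemma trunc_low i x : trunc i x \in lowcoord i.
Proof. by apply/lowcoordP => j; rewrite leqNgt mxE => /negPf ->. Qed.

Lemma trunc_id i x : x \in lowcoord i -> trunc i x = x.
Proof.
move=> /lowcoordP hx; apply/rowP => j; rewrite mxE.
by case: ltnP => // /hx.
Qed.

Lemma truncS i (ltiN : (i < N)%N) x : x \in lowcoord i.+1 ->
  x = x 0 (Ordinal ltiN) *: delta_mx 0 (Ordinal ltiN) + trunc i x.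
Proof.
move=> /lowcoordP hx; apply/rowP => j; rewrite !mxE /=.
have [->|ji] := eqVneq j (Ordinal ltiN); first by rewrite /= ltnn mulr1 addr0.
rewrite mulr0 add0r; case: ltnP => // ij; apply: hx.
rewrite ltn_neqAle ij andbT; apply: contra ji => /eqP ji.
by apply/eqP/val_inj.
Qed.

Lemma coord_functional (i : 'I_N) : functional (fun x : 'rV[F]_N => x 0 i).
Proof. by move=> c x y; rewrite !mxE. Qed.

Lemma form_extend p (k : seq 'rV[F]_N -> Prop) psi phi i (ltiN : (i < N)%N) :
  geomhyp p.+1 k -> altform p psi -> altform p.+1 phi ->
  (forall s, size s = p -> (k (s ++ [:: delta_mx 0 (Ordinal ltiN)]) <-> psi s = 0)) ->
  (forall s, size s = p.+1 -> all [in lowcoord i] s -> (k s <-> phi s = 0)) ->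
  exists2 f, altform p.+1 f & forall s, size s = p.+1 ->
    all [in lowcoord i.+1] s -> (k s <-> f s = 0).
Proof.
move=> gk apsi aphi kpsi kphi.
pose o := Ordinal ltiN; pose e : 'rV[F]_N := delta_mx 0 o.
(* Since [trunc i] kills [e], the form [phi'] takes the same value at [e + x] as at [x], and it
   agrees with [phi] on H. *)
pose phi' s := phi (map (trunc i) s).
have aphi' : altform p.+1 phi' := altform_comp (@trunc_lin i) aphi.
have tid s : all [in lowcoord i] s -> map (trunc i) s = s.
  move=> Hs; rewrite -[RHS]map_id; apply/eq_in_map => x xs.
  by apply: trunc_id; exact: (allP Hs).
have ag : agree (lowcoord i) e p k psi phi'.
  split=> [Y szY _|s szs Hs]; first exact: kpsi.
  by rewrite /phi' tid //; apply: kphi.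
have [lam lam0 rat] := exists_ratio (@lowcoord_lin i) gk apsi aphi' ag.
pose eps (x : 'rV[F]_N) := x 0 o; have leps : functional eps := @coord_functional o.
have low_eps x : x \in lowcoord i -> eps x = 0 by move/lowcoordP; apply.
have eps_low x : x \in lowcoord i.+1 -> eps x = 0 -> x \in lowcoord i.
  by move=> /(truncS ltiN) xE ex; rewrite xE -/(eps x) ex scale0r add0r trunc_low.
have eps_e : eps e = 1 by rewrite /eps mxE !eqxx.
have all_eps s : all [in lowcoord i] s -> all [pred x | eps x == 0] s.
  by apply: sub_all => x /low_eps /eqP.
(* The wedge vanishes on H and equals [psi Y] at [Y], [e + x], so [f] restricts to [phi'] on H and
   to the expression of [ratio] on [e + H]. *)
pose f s := phi' s + lam * wedge eps psi s.
have af : altform p.+1 f by apply: altform_lin => //; exact: wedge_altform.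
exists f => // s szs Hs.
have [low|] := boolP (all [in lowcoord i] s).
  by rewrite /f wedge_vanish ?all_eps // mulr0 addr0 /phi' tid //; apply: kphi.
case/allPn => x xs nlx.
have Hx : x \in lowcoord i.+1 by exact: (allP Hs).
have ex : eps x != 0 by apply: contra nlx => /eqP; exact: eps_low.
(* A vector [x] outside H serves as pivot: the others are sheared into H and [x] is scaled to [e]
   plus a vector of H. *)
pose t := rem x s; have st := perm_to_rem xs.
have szt : size t = p by rewrite size_rem // szs.
have perm Q : geomhyp p.+1 Q -> Q s <-> Q (x :: t).
  by move=> [pQ _ _]; split; apply: pQ; rewrite /= ?szt // perm_sym.
rewrite (perm k gk) (perm _ (altform_geomhyp af)).
pose b y := eps y / eps x.
have ex' : (eps x)^-1 != 0 by rewrite invr_eq0.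
rewrite (geomhyp_reduce b x gk szt ex').
rewrite (geomhyp_reduce b x (altform_geomhyp af) szt ex').
set Y := map _ t.
have szY : size Y = p by rewrite size_map.
have HY : all [in lowcoord i] Y.
  apply/allP => _ /mapP [y yt ->]; apply: eps_low.
    rewrite addrC -scaleNr; apply: lowcoord_lin => //.
    by apply: (allP Hs); exact: (mem_rem yt).
  by rewrite /b (functionalB leps) (functionalZ leps) divfK // subrr.
have -> : (eps x)^-1 *: x = e + (eps x)^-1 *: trunc i x.
  by rewrite {2}(truncS ltiN Hx) scalerDr scalerA mulVf // scale1r.
have Hc : (eps x)^-1 *: trunc i x \in lowcoord i.
  by rewrite -[_ *: _]addr0 lowcoord_lin ?trunc_low //; apply/lowcoordP => j _; rewrite mxE.
rewrite (rat Y _ szY HY Hc) /f (wedge_last _ _ (all_eps _ HY)).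
rewrite (functionalD leps) [eps _ as X in X + _]eps_e [eps (_ *: _)](low_eps _ Hc) addr0 mul1r.
suff -> : phi' (Y ++ [:: e + (eps x)^-1 *: trunc i x]) =
          phi' (Y ++ [:: (eps x)^-1 *: trunc i x]) by [].
rewrite /phi' !map_cat /=; congr (phi (_ ++ [:: _])).
rewrite -[e]scale1r trunc_lin (_ : trunc i e = 0) ?scaler0 ?add0r //.
apply/rowP => j; rewrite !mxE; case: ifP => // ji.
by rewrite andTb; case: eqP => // jo; rewrite jo ltnn in ji.
Qed.

Theorem geomhyp_altform p (k : seq 'rV[F]_N -> Prop) : geomhyp p k ->
  exists2 f, altform p f & forall s, size s = p -> (k s <-> f s = 0).
Proof.
elim: p k => [|p IHp] k gk.
  have zero_form c : altform 0 (fun _ : seq 'rV[F]_N => c : F) by split.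
  have [k0|k0] := classic (k [::]).
    by exists (fun _ => 0) => // -[].
  by exists (fun _ => 1) => // -[] //= _; split=> // /eqP; rewrite oner_eq0.
suff low i : (i <= N)%N -> exists2 f, altform p.+1 f & forall s, size s = p.+1 ->
    all [in lowcoord i] s -> (k s <-> f s = 0).
  have [f af kf] := low N (leqnn N); exists f => // s szs.
  apply: kf => //; apply/allP => x _; apply/lowcoordP => j.
  by rewrite leqNgt ltn_ord.
elim: i => [_|i IHi ltiN].
  (* On the zero subspace the zero form works, as the functional of the first slot vanishes at 0. *)
  exists (fun _ => 0); first by split=> [s1 s2 _ c x y|//]; rewrite mulr0 addr0.
  move=> [|x s] //= [szs] /andP [/lowcoordP hx _]; split=> // _.
  have [_ _ /(_ s)] := gk; case; rewrite ?szs // => a la ak.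
  by apply/ak; rewrite (_ : x = 0) ?functional0 //; apply/rowP => j; rewrite hx ?mxE.
have [phi aphi kphi] := IHi (ltnW ltiN).
pose e : 'rV[F]_N := delta_mx 0 (Ordinal ltiN).
have [psi apsi kpsi] := IHp _ (geomhyp_contract e gk).
apply: (form_extend (ltiN := ltiN) gk apsi aphi _ kphi) => s szs.
rewrite -(kpsi s szs); have [pk _ _] := gk.
by rewrite cats1; split; apply: pk; rewrite ?size_rcons /= ?szs // ?perm_rcons // perm_sym perm_rcons.
Qed.

End Existence.

(** Expand each slot along [bs]: terms with a repeated vector vanish, and the hypothesis covers the
    others. *)
Lemma altform_span0 (F : fieldType) (V : vectType F) p (f : seq V -> F) bs s :
  altform p f ->
  (forall t, size t = p -> uniq t -> {subset t <= bs} -> f t = 0) ->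
  size s = p -> {subset s <= <<bs>>%VS} -> f s = 0.
Proof.
elim: p f s => [|p IH] f [|x s] // af f0.
  by move=> _ _; apply: f0.
move=> [szs] sub; have lf := altform_head af (congr1 S szs).
have xb : x \in <<in_tuple bs>>%VS by apply: sub; rewrite mem_head.
rewrite (coord_span xb) (functional_sum lf) big1 // => i _.
rewrite (functionalZ lf); set b := (in_tuple bs)`_i.
have bb : b \in bs by apply: mem_nth.
rewrite (IH (fun s => f (b :: s))) ?mulr0 //; first exact: altform_contract.
  move=> t szt ut tb; have [bt|bt] := boolP (b \in t).
    by apply: (altform_repeat af) => //; rewrite szt.
  apply: f0; rewrite /= ?szt ?bt // => y; rewrite inE => /predU1P [->//|].
  exact: tb.
by move=> y ys; apply: sub; rewrite inE ys orbT.
Qed.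

(** * Alternating forms in Plücker coordinates *)

Section Plucker.
Variables (F : fieldType) (n h : nat).
Local Notation N := n.+1.
Local Notation p := h.+1.
Implicit Types (s : seq 'rV[F]_N) (g : {ffun 'I_p -> 'I_N}).

Definition rows_mx s : 'M[F]_(p, N) := \matrix_(i, j) (nth 0 s i) 0 j.

Lemma det_altform g : altform p (fun s => \det (colsub g (rows_mx s))).
Proof.
have nth_mid (s1 s2 : seq 'rV[F]_N) x i : i != size s1 ->
    nth 0 (s1 ++ x :: s2) i = nth 0 (s1 ++ 0 :: s2) i.
  move=> ni; rewrite !nth_cat; case: ltnP => // le.
  have : (0 < i - size s1)%N by rewrite subn_gt0 ltn_neqAle eq_sym ni.
  by case: (i - size s1)%N.
split=> [s1 s2 sz c x y|s1 s2 x sz].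
  have lt1 : (size s1 < p)%N by rewrite -sz ltnS leq_addr.
  rewrite /= -[\det (colsub g (rows_mx (s1 ++ y :: s2)))]mul1r.
  apply: (@determinant_multilinear _ _ _ _ _ (Ordinal lt1)).
  - by apply/rowP => j; rewrite !mxE /= !nth_cat !ltnn !subnn /= !mxE mul1r.
  - apply/matrixP => i j; have ne := neq_lift (Ordinal lt1) i; rewrite eq_sym in ne.
    by rewrite !mxE (nth_mid _ _ x) // (nth_mid _ _ (c *: x + y)).
  - apply/matrixP => i j; have ne := neq_lift (Ordinal lt1) i; rewrite eq_sym in ne.
    by rewrite !mxE (nth_mid _ _ y) // (nth_mid _ _ (c *: x + y)).
have lt2 : ((size s1).+1 < p)%N by rewrite -sz !ltnS leq_addr.
apply: (@determinant_alternate _ _ _ (Ordinal (ltnW lt2)) (Ordinal lt2)).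
  by rewrite -val_eqE /= neq_ltn ltnSn.
by move=> j; rewrite !mxE /= !nth_cat ltnn subnn ltnNge leqnSn /= subSnn.
Qed.

Lemma plucker_altform (c : {ffun {ffun 'I_p -> 'I_N} -> F}) :
  altform p (fun s => plucker_form c (rows_mx s)).
Proof.
split=> [s1 s2 sz b x y|s1 s2 x sz]; rewrite /plucker_form.
  rewrite mulr_sumr -big_split; apply: eq_bigr => g _ /=.
  rewrite ((det_altform g).1 s1 s2 sz b x y) /=; ring.
by rewrite big1 // => g _; rewrite ((det_altform g).2 s1 s2 x sz) mulr0.
Qed.

Lemma incr_sorted g : incr g -> sorted ltn [seq val (g i) | i <- enum 'I_p].
Proof.
move=> /forallP gi.
apply: (homo_sorted (e := relpre val ltn)).
  by move=> i j ij; have /forallP /(_ j) /implyP := gi i; apply.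
by rewrite -sorted_map val_enum_ord iota_ltn_sorted.
Qed.

Lemma incr_inj g : incr g -> injective g.
Proof.
move=> /forallP gi i j gij.
have lt (a b : 'I_p) : (a < b)%N -> (g a < g b)%N.
  by have /forallP /(_ b) /implyP := gi a.
case: (ltngtP i j) => [/lt|/lt|/val_inj //]; by rewrite gij ltnn.
Qed.

(** The two lists of values are strictly sorted and of equal length, so inclusion of the images
    makes them equal. *)
Lemma incr_codom_eq g g0 : incr g -> incr g0 -> {subset codom g0 <= codom g} ->
  g0 = g.
Proof.
move=> ig ig0 sub; apply/ffunP => i.
pose L (u : {ffun 'I_p -> 'I_N}) := [seq val (u i) | i <- enum 'I_p].
have subL : {subset L g0 <= L g}.
  move=> _ /mapP [j _ ->]; have /codomP [j' ->] := sub _ (codom_f g0 j).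
  by apply/mapP; exists j' => //; rewrite mem_enum.
have sL u : incr u -> sorted ltn (L u) by exact: incr_sorted.
have uL : uniq (L g0) by apply: (sorted_uniq ltn_trans ltnn); exact: sL.
have [|_ eqL] := uniq_min_size uL subL; first by rewrite !size_map.
have := irr_sorted_eq ltn_trans ltnn (sL _ ig0) (sL _ ig) eqL.
by move/eq_in_map/(_ i); rewrite mem_enum => /(_ isT) /val_inj.
Qed.

(** If the maps differ, [incr_codom_eq] yields a value of [g0] that [g] misses, and its row is
    zero. *)
Lemma det_incr g g0 : incr g -> incr g0 ->
  \det (\matrix_(i, j) (g0 i == g j)%:R : 'M[F]_p) = (g == g0)%:R.
Proof.
move=> ig ig0; have [<-|ne] := eqVneq g g0.
  rewrite (_ : \matrix_(i, j) _ = 1%:M) ?det1 //.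
  by apply/matrixP => i j; rewrite !mxE (inj_eq (incr_inj ig)).
have [i ni] : exists i, g0 i \notin codom g.
  apply: NNPP => none; move/eqP: ne; apply; apply/esym/incr_codom_eq => //.
  by move=> _ /codomP [i ->]; apply: contraPT none => ni none; apply: none; exists i.
rewrite (expand_det_row _ i) big1 // => j _; rewrite mxE.
case: eqP => [gij|_]; last by rewrite mul0r.
by rewrite gij codom_f in ni.
Qed.

(** The coefficients are the values of [f] on increasing tuples of unit vectors. The difference of
    the two forms vanishes there by [det_incr], on repetition-free tuples by sorting, and everywhere
    by [altform_span0]. *)
Lemma altform_plucker (f : seq 'rV[F]_N -> F) : altform p f ->
  exists c : {ffun {ffun 'I_p -> 'I_N} -> F}, forall s, size s = p ->
    f s = plucker_form c (rows_mx s).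
Proof.
move=> af.
pose d (j : 'I_N) : 'rV[F]_N := delta_mx 0 j.
pose c := [ffun g : {ffun 'I_p -> 'I_N} => f [seq d (g i) | i <- enum 'I_p]].
exists c => s szs; apply/eqP; rewrite -subr_eq0 -mulN1r; apply/eqP.
have aD := altform_lin (-1) af (plucker_altform c).
apply: (altform_span0 (bs := [seq d j | j <- enum 'I_N]) aD _ szs); last first.
  move=> x _; rewrite [x]row_sum_delta; apply: memv_suml => j _; apply: memvZ.
  by apply: memv_span; apply: map_f; rewrite mem_enum.
move=> t szt ut tb.
have dinj : injective d.
  move=> i j /rowP /(_ i); rewrite !mxE !eqxx /=.
  by case: eqP => // _ /eqP; rewrite oner_eq0.
have [js tE] : exists js, t = map d js.
  elim: t tb {szt ut} => [|x t IH] tb; first by exists [::].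
  have /mapP [j _ ->] := tb x (mem_head _ _).
  have [y yt|js ->] := IH; first by apply: tb; rewrite inE yt orbT.
  by exists (j :: js).
pose js' := sort (relpre val leq) js.
have pj : perm_eq js' js by rewrite perm_sort.
have szj : size js' = p by rewrite (perm_size pj) -szt tE size_map.
have uj : uniq js' by rewrite (perm_uniq pj); rewrite tE map_inj_uniq // in ut.
rewrite tE; apply: (altform_perm0 aD _ (perm_map d pj)); first by rewrite size_map.
have srt : sorted (relpre val ltn) js'.
  rewrite -sorted_map ltn_sorted_uniq_leq map_inj_uniq ?uj //; last exact: val_inj.
  by rewrite sorted_map sort_sorted // => i j; exact: leq_total.
pose g0 : {ffun 'I_p -> 'I_N} := [ffun i : 'I_p => nth ord0 js' i].
have ig0 : incr g0.
  apply/forallP => i; apply/forallP => j; apply/implyP => ij; rewrite !ffunE.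
  apply: (sorted_ltn_nth (leT := relpre val ltn)) => //; rewrite ?inE ?szj //.
  by move=> a b e; exact: ltn_trans.
have jsE : js' = [seq g0 i | i <- enum 'I_p].
  apply: (@eq_from_nth _ ord0) => [|i]; first by rewrite size_map size_enum_ord.
  rewrite szj => ip.
  by rewrite (nth_map (Ordinal ip)) ?size_enum_ord // ffunE nth_enum_ord.
rewrite mulN1r; apply/eqP; rewrite subr_eq0; apply/eqP.
rewrite /plucker_form (bigD1 g0) //= big1 ?addr0 => [|g /andP [ig ng]].
  rewrite (_ : colsub g0 _ = \matrix_(i, j) (g0 i == g0 j)%:R).
    by rewrite det_incr // eqxx mulr1 ffunE jsE -map_comp.
  apply/matrixP => i j; rewrite !mxE (nth_map ord0) ?szj // !mxE eqxx /=.
  by rewrite [g0 i]ffunE eq_sym.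
rewrite (_ : colsub g _ = \matrix_(i, j) (g0 i == g j)%:R).
  by rewrite det_incr // (negPf ng) mulr0.
apply/matrixP => i j; rewrite !mxE (nth_map ord0) ?szj // !mxE eqxx /=.
by rewrite [g0 i]ffunE eq_sym.
Qed.

End Plucker.

(** For a fixed [y] outside P, the value [a x] is the only [c] with [P (x - c *: y)]; linearity
    follows from this uniqueness. *)
Lemma exists_functional (F : fieldType) (V : lmodType F) (P : V -> Prop) :
  (forall c x y, P x -> P y -> P (c *: x + y)) ->
  (forall x y, ~ P y -> exists c : F, P (x - c *: y)) ->
  exists2 a, functional a & forall x, P x <-> a x = 0.
Proof.
move=> Plin Pcodim.
have [all|/not_all_ex_not [y Py]] := classic (forall x, P x).
  by exists (fun _ => 0) => // c x y; rewrite mulr0 addr0.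
have Pdec x : {c | P (x - c *: y)}.
  by apply: constructive_indefinite_description; exact: Pcodim.
pose a x := sval (Pdec x); have Pa x : P (x - a x *: y) := svalP (Pdec x).
have P0 : P 0 by have := Plin (-1) _ _ (Pa y) (Pa y); rewrite scaleN1r addNr.
have uniq x c : P (x - c *: y) -> a x = c.
  move=> Pc; apply/eqP; rewrite -subr_eq0; apply/negPn/negP => d0.
  apply: Py; have := Plin (-1) _ _ (Pa x) Pc.
  rewrite scaleN1r opprB addrA subrK -scalerBl => Pd.
  have := Plin (a x - c)^-1 _ _ Pd P0.
  by rewrite scalerA mulVf // scale1r addr0.
exists a => [c u v|x].
  apply: uniq; rewrite scalerDl opprD addrACA -scalerA -scalerBr.
  exact: Plin.
split=> [Px|ax]; first by apply: uniq; rewrite scale0r subr0.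
by have := Pa x; rewrite ax scale0r subr0.
Qed.

(** * Lines, hyperplanes and dimensions of subspaces *)

Section Subspaces.
Variables (F : fieldType) (vT : vectType F).
Implicit Types (U V W X P : {vspace vT}) (x y v : vT).

Lemma memv_add_lineP U x v :
  reflect (exists2 u, u \in U & exists c, v = u + c *: x) (v \in (U + <[x]>)%VS).
Proof.
apply: (iffP memv_addP) => [[u Uu [w /vlineP [c ->] ->]]|[u Uu [c ->]]].
  by exists u => //; exists c.
by exists u => //; exists (c *: x) => //; exact: memvZ (memv_line x).
Qed.

Lemma dim_add_line U x : x \notin U -> \dim (U + <[x]>) = (\dim U).+1.
Proof.
move=> Ux; have x0 : x != 0 by apply: contraNneq Ux => ->; exact: mem0v.
rewrite dimv_disjoint_sum ?dim_vline ?x0 ?addn1 //.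
apply/eqP; rewrite -subv0; apply/subvP => v /memv_capP [Uv /vlineP [c vE]].
have [c0|c0] := eqVneq c 0; first by rewrite vE c0 scale0r mem0v.
by case/negP: Ux; move: Uv; rewrite vE rpredZeq (negPf c0).
Qed.

Lemma add_line_eq U V x : (U <= V)%VS -> \dim V = (\dim U).+1 -> x \in V ->
  x \notin U -> (U + <[x]>)%VS = V.
Proof.
move=> UV dV Vx Ux; apply/eqP; rewrite eqEdim subv_add UV -memvE Vx /=.
by rewrite dim_add_line // dV.
Qed.

Lemma dim1_line P : \dim P = 1%N -> exists2 b, b != 0 & P = <[b]>%VS.
Proof.
move=> dP; have P0 : P != 0%VS by rewrite -dimv_eq0 dP.
exists (vpick P); first by rewrite vpick0.
by apply/eqP; rewrite eq_sym eqEdim -memvE memv_pick dP dim_vline vpick0 P0.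
Qed.

Lemma hyperplane_avoiding V x : x \in V -> x != 0 ->
  exists X, [/\ (X <= V)%VS, (\dim X).+1 = \dim V & x \notin X].
Proof.
move=> Vx x0; exists (V :\: <[x]>)%VS; split; first exact: diffvSl.
  rewrite -(dimv_cap_compl V <[x]>) (capv_idPr _) ?dim_vline ?x0 -?memvE //.
apply: contra x0 => Xx; rewrite -memv0 -(capv_diff V <[x]>) memv_cap Xx.
exact: memv_line.
Qed.

Lemma hyperplane_separating V x y : x \in V -> y \in V -> y \notin <[x]>%VS ->
  exists X, [/\ (X <= V)%VS, (\dim X).+1 = \dim V, x \in X & y \notin X].
Proof.
move=> Vx Vy xy; pose L := (<[x]> + <[y]>)%VS; pose X := (V :\: L + <[x]>)%VS.
have LV : (L <= V)%VS by rewrite subv_add -!memvE Vx.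
have XV : (X <= V)%VS by rewrite subv_add diffvSl -memvE.
have XyV : (X + <[y]>)%VS = V by rewrite -addvA addv_diff; apply/addv_idPl.
have yX : y \notin X.
  apply/negP => Xy.
  have VX : X = V by rewrite -[RHS]XyV; apply/esym/addv_idPl; rewrite -memvE.
  have := dimv_cap_compl V L; rewrite (capv_idPr LV) -[in RHS]VX dim_add_line //.
  have := (dimv_add_leqif (V :\: L) <[x]>).1; rewrite -/X VX.
  have := dim_vline x; case: (x != 0) => /= ->; lia.
exists X; split=> //; last by rewrite (subvP (addvSr _ _)) ?memv_line.
by rewrite -XyV dim_add_line.
Qed.

End Subspaces.

(** * Poles with respect to the complex of an alternating form *)

Section Poles.
Variables (F : fieldType) (vT : vectType F) (h : nat) (f : seq vT -> F).
Hypothesis af : altform h.+1 f.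
Implicit Types (V X P : {vspace vT}) (s t : seq vT).

(** Repetition-free sequences of length [h.+1] drawn from [s] are permutations of [s], so one zero
    on a spanning sequence suffices. *)
Lemma altform_basis0 s t : size s = h.+1 -> f s = 0 -> size t = h.+1 ->
  {subset t <= <<s>>%VS} -> f t = 0.
Proof.
move=> szs fs szt sub; apply: (altform_span0 af _ szt sub) => u szu uu us.
apply: (altform_perm0 af szs _ fs); rewrite perm_sym.
have szus : (size s <= size u)%N by rewrite szs szu.
have [_ eq_us] := uniq_min_size uu us szus.
by apply: uniq_perm => //; exact: leq_size_uniq uu us szus.
Qed.

Variable K : {vspace vT} -> Prop.
Hypothesis Kf : forall X, K X <->
  \dim X = h.+1 /\ forall s, size s = h.+1 -> <<s>>%VS = X -> f s = 0.

Lemma complex_span s : size s = h.+1 -> \dim <<s>> = h.+1 -> f s = 0 -> K <<s>>%VS.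
Proof.
move=> szs ds fs; apply/Kf; split=> // t szt ts.
by apply: (altform_basis0 szs fs szt) => x xt; rewrite -ts memv_span.
Qed.

(* If [f xs <> 0] and V is spanned by xs and v, the pole is spanned by the
   vector q = v - sum_x c_x x for which replacing any x in xs by q kills f
   (Cramer's rule); the contraction of f by q then vanishes on all of V. *)
Lemma exists_pole V : \dim V = h.+2 -> ~ total_sub h K V ->
  exists P, is_pole h K V P.
Proof.
move=> dV ntot.
have [X [dX XV nKX]] : exists X, [/\ \dim X = h.+1, (X <= V)%VS & ~ K X].
  apply: NNPP => none; apply: ntot => X dX XV; apply: NNPP => nK.
  by apply: none; exists X.
have [xs [szx xsX fx]] : exists xs, [/\ size xs = h.+1, <<xs>>%VS = X & f xs <> 0].
  apply: NNPP => none; apply: nKX; apply/Kf; split=> // s szs sX.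
  by apply: NNPP => fs; apply: none; exists s.
have [v Vv nXv] : exists2 v, v \in V & v \notin X.
  by apply/subvPn; apply/negP => /dimvS; rewrite dV dX ltnn.
have xsV x : x \in xs -> x \in V by move=> xx; apply: (subvP XV); rewrite -xsX memv_span.
have uxs : uniq xs.
  have /free_uniq // : free xs by rewrite /free xsX dX szx.
pose c x := f (v :: rem x xs) / f (x :: rem x xs).
pose q := v - \sum_(x <- xs) c x *: x.
have nXq : q \notin X.
  apply: contra nXv => Xq; rewrite -(subrK (\sum_(x <- xs) c x *: x) v) rpredD //.
  rewrite big_seq rpred_sum // => x xx.
  by rewrite rpredZ // -xsX memv_span.
have Vq : q \in V.
  rewrite rpredB // big_seq rpred_sum // => x xx.
  by rewrite rpredZ // xsV.
have q0 : q != 0 by apply: contraNneq nXq => ->; exact: mem0v.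
have szr x : x \in xs -> size (rem x xs) = h by move=> xx; rewrite size_rem // szx.
have fq x : x \in xs -> f (q :: rem x xs) = 0.
  move=> xx; have szrx := congr1 S (szr x xx).
  have lf := altform_head af szrx.
  have fx0 : f (x :: rem x xs) != 0.
    apply/eqP => f0; apply: fx; apply: (altform_perm0 (s := x :: rem x xs) af szrx _ f0).
    by rewrite perm_sym perm_to_rem.
  rewrite (functionalB lf) (functional_sum lf) (bigD1_seq x) //= (functionalZ lf).
  rewrite divfK // big_seq_cond big1 ?addr0 ?subrr // => y /andP [yx ny].
  rewrite (functionalZ lf) (altform_repeat af szrx) ?mulr0 //.
  by rewrite mem_rem_uniq // inE ny.
have spanq U ys : \dim U = h.+1 -> <<ys>>%VS = U -> (U <= V)%VS -> q \notin U ->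
    <<q :: ys>>%VS = V.
  move=> dU ysU UV nq; rewrite span_cons addvC ysU; apply: add_line_eq => //.
  by rewrite dV dU.
(* A repetition-free sequence drawn from [q :: xs] either contains [q], a repetition after
   contraction, or omits exactly one [x] of [xs], the case settled by [fq]. *)
have iq t : size t = h -> {subset t <= V} -> f (q :: t) = 0.
  move=> szt tV; apply: (@altform_span0 _ _ h (fun t => f (q :: t)) (q :: xs)) => //.
  - exact: altform_contract.
  - move=> u szu uu us; have [qu|qu] := boolP (q \in u).
      by apply: (altform_repeat af) => //; rewrite szu.
    have uxs' : {subset u <= xs}.
      move=> y yu; have := us y yu; rewrite inE => /predU1P [yq|//].
      by rewrite -yq yu in qu.
    have /allPn [x xx nu] : ~~ all [in u] xs.
      by apply/negP => /allP /(uniq_leq_size uxs); rewrite szx szu ltnn.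
    have ur : {subset u <= rem x xs}.
      move=> y yu; rewrite mem_rem_uniq // inE uxs' // andbT.
      by apply: contraNneq nu => <-.
    apply: (altform_perm0 (s := q :: rem x xs) af _ _ (fq x xx)); first by rewrite /= szr.
    rewrite perm_cons perm_sym; apply: uniq_perm => //; first exact: rem_uniq.
    by have [|//] := uniq_min_size uu ur; rewrite szr // szu.
  - by move=> y yt; rewrite (spanq X) // tV.
exists <[q]>%VS; split; first by rewrite dim_vline q0.
split=> [|Y dY YV]; first by rewrite -memvE.
rewrite -memvE; split=> [KY|Yq].
  (* If [q] were outside Y, then [q] and a basis of Y would span V. As [f] vanishes on every choice
     among them, [f xs] would be 0. *)
  apply/negPn/negP => nq; apply: fx.
  pose ys := vbasis Y; have szy : size ys = h.+1 by rewrite size_tuple dY.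
  have ysY : <<ys>>%VS = Y by apply: span_basis; exact: vbasisP.
  have fy : f ys = 0 by have [_] := (Kf Y).1 KY; apply.
  apply: (altform_span0 (bs := q :: ys) af _ szx) => [u szu uu us|y yx]; last first.
    by rewrite (spanq Y) // xsV.
  have uV : {subset u <= V}.
    by move=> y yu; rewrite -(spanq Y ys) // memv_span // us.
  have [qu|qu] := boolP (q \in u).
    have szru : size (rem q u) = h by rewrite size_rem // szu.
    apply: (altform_perm0 (s := q :: rem q u) af); first by rewrite /= szru.
      by rewrite perm_sym perm_to_rem.
    by apply: iq => // y /mem_rem; exact: uV.
  apply: (altform_basis0 szy fy szu) => y yu; have := us y yu.
  rewrite inE => /predU1P [yq|yy]; last exact: memv_span.
  by rewrite -yq yu in qu.
pose ys := vbasis (Y :\: <[q]>)%VS.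
have ysE : <<q :: ys>>%VS = Y.
  rewrite span_cons (span_basis (vbasisP _)) addvC addv_diff.
  by apply/addv_idPl; rewrite -memvE.
have szy : size ys = h.
  have := dimv_cap_compl Y <[q]>; rewrite (capv_idPr _) -?memvE // dim_vline q0 dY.
  by rewrite size_tuple => -[].
rewrite -ysE; apply: complex_span => /=; rewrite ?szy ?ysE //.
apply: iq => // y yy; apply: (subvP YV); rewrite -ysE memv_span //.
by rewrite inE yy orbT.
Qed.

End Poles.

(** * Uniqueness of the value of the dual polarity *)

Section PolaritySpec.
Variables (F : fieldType) (vT : vectType F) (h : nat) (K : {vspace vT} -> Prop).
Implicit Types (V P : {vspace vT}).

Definition polarity_spec V (o : option {vspace vT}) := match o with
  | None => \dim V <> h.+2 \/ total_sub h K V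
  | Some P => \dim V = h.+2 /\ ~ total_sub h K V /\ is_pole h K V P
  end.

Lemma dual_polarityP V o : polarity_spec V o ->
  polarity_spec V (dual_polarity h K V).
Proof. by move=> so; apply: (epsilon_spec (inhabits None)); exists o. Qed.

(** If two poles of V differed, a hyperplane of V through one and missing the other would both
    belong and not belong to K. *)
Lemma polarity_spec_uniq V o1 o2 : polarity_spec V o1 -> polarity_spec V o2 ->
  o1 = o2.
Proof.
have incl P P' : \dim V = h.+2 -> is_pole h K V P -> is_pole h K V P' -> (P <= P')%VS.
  move=> dV [dP [PV pP]] [dP' [PV' pP']].
  have [b b0 PE] := dim1_line dP; have [b' b0' PE'] := dim1_line dP'.
  rewrite {}PE {}PE' -?memvE in PV pP PV' pP' *.
  apply/negPn/negP => nb.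
  have [X [XV dX Xb Xb']] := hyperplane_separating PV' PV nb.
  have dX' : \dim X = h.+1 by move: dX; rewrite dV => -[].
  have := (pP' X dX' XV).2; rewrite -memvE => /(_ Xb) /(pP X dX' XV).1.
  by rewrite -memvE (negPf Xb').
case: o1 o2 => [P|] [P'|] //=; last first.
- by move=> [dV|tot] [dV' [ntot _]].
- by move=> [dV' [ntot _]] [dV|tot].
move=> [dV [_ pP]] [_ [_ pP']]; congr Some; apply/eqP.
rewrite eqEdim (incl P P') //=.
by have [-> _] := pP; have [-> _] := pP'.
Qed.

End PolaritySpec.

(** * The complex defined by a linear mapping *)

Section LinearMapping.
Variables (F : fieldType) (vT : vectType F) (h : nat) (chi : partial_map vT).
Hypotheses (lchi : linear_mapping h.+1 0 chi)
  (chi_in : forall V P, chi V = Some P -> (P <= V)%VS).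
Implicit Types (U V W X P : {vspace vT}) (x y v : vT) (s : seq vT).

Lemma chi_dim V P : chi V = Some P -> \dim V = h.+2 /\ \dim P = 1%N.
Proof. by case: lchi => /(_ V P) pm _ /pm. Qed.

(* In the pencil of (X, V0 + V), a point outside X in the image forces every
   member of the pencil to be in the domain with image outside X. *)
Lemma chi_star X V0 V P : \dim X = h.+1 -> (X <= V0)%VS -> \dim V0 = h.+2 ->
  (X <= V)%VS -> (forall P0, chi V0 = Some P0 -> (P0 <= X)%VS) ->
  chi V = Some P -> (P <= X)%VS.
Proof.
move=> dX XV0 dV0 XV in0 cV; have [dV dP] := chi_dim cV.
have [V0V|neq] := eqVneq V0 V; first by apply: in0; rewrite V0V.
have dS U : \dim U = h.+2 -> \dim U = (\dim X).+1 by rewrite dX.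
have [b b0 PE] := dim1_line dP.
have Vb : b \in V by rewrite memvE -PE; exact: chi_in.
have [v0 V0v0 nXv0] : exists2 v0, v0 \in V0 & v0 \notin X.
  by apply/subvPn; apply/negP => /dimvS; rewrite dX dV0 ltnn.
have [v Vv nXv] : exists2 v, v \in V & v \notin X.
  by apply/subvPn; apply/negP => /dimvS; rewrite dX dV ltnn.
have nVv0 : v0 \notin V.
  apply: contra neq => Vv0; apply/eqP.
  by rewrite -(add_line_eq XV0 (dS _ dV0) V0v0) // -(add_line_eq XV (dS _ dV) Vv0).
have nV0v : v \notin V0.
  apply: contra neq => V0v; apply/eqP.
  by rewrite -(add_line_eq XV0 (dS _ dV0) V0v) // -(add_line_eq XV (dS _ dV) Vv).
pose W := (V0 + <[v]>)%VS.
have V0W : (V0 <= W)%VS by exact: addvSl.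
have VW : (V <= W)%VS.
  rewrite -(add_line_eq XV (dS _ dV) Vv) // subv_add (subv_trans XV0 V0W) /=.
  exact: addvSr.
pose L := pencil h.+1 X W.
have LL : grass_line h.+1 L.
  exists X, W; rewrite dX dim_add_line // dV0; do 3 split=> //.
  exact: subv_trans XV0 V0W.
have LV0 : L V0 by [].
have LV : L V by [].
have [_ /(_ L LL)] := lchi.
case=> [[[[U' [W' [dU' [_ [_ imL]]]]] [dom _]] _]|[[_ [[im exc] _]]|[_ [_ none]]]].
(* The image is a line through [P0] and [P], so [<[a + b]>] is the image of some [V2]. With [a] in
   X, [V2] contains [b], hence equals V, although the two images differ. *)
- case c0: (chi V0) => [P0|]; last by case: (dom V0 LV0).
  have P0X := in0 _ c0; have [_ dP0] := chi_dim c0.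
  apply/negPn/negP; rewrite PE -memvE => nXb.
  have [a a0 P0E] := dim1_line dP0.
  have Xa : a \in X by rewrite memvE -P0E.
  have nXab : a + b \notin X by rewrite rpredDl.
  have [_ [P0W _]] := (imL P0).1 (ex_intro _ V0 (conj LV0 c0)).
  have [_ [PW _]] := (imL P).1 (ex_intro _ V (conj LV cV)).
  have [|V2 [[XV2 [_ dV2]] c2]] := (imL <[a + b]>%VS).2.
    split; first by move/eqP: dU'; rewrite dimv_eq0 => /eqP ->; exact: sub0v.
    split; first by rewrite -memvE rpredD // memvE -?P0E -?PE.
    by rewrite dim_vline; case: eqP nXab => // ->; rewrite mem0v.
  have V2ab : a + b \in V2 by rewrite memvE; exact: chi_in.
  have V2b : b \in V2 by rewrite -(rpredDl _ (subvP XV2 _ Xa)).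
  have V2V : V2 = V.
    by rewrite -(add_line_eq XV2 (dS _ dV2) V2b) // -(add_line_eq XV (dS _ dV) Vb).
  move: c2; rewrite V2V cV => -[]; rewrite PE => Pab.
  have : a + b \in <[b]>%VS by rewrite Pab memv_line.
  rewrite rpredDr ?memv_line // => /vlineP [c aE].
  have [c0'|c0'] := eqVneq c 0; first by move: a0; rewrite aE c0' scale0r eqxx.
  by move: Xa; rewrite aE rpredZeq (negPf c0') (negPf nXb).
- have [Y [_ imY]] := im.
  have PY : P = Y by apply/imY; exists V.
  case c0: (chi V0) => [P0|].
    have P0Y : P0 = Y by apply/imY; exists V0.
    by rewrite PY -P0Y; exact: in0.
  have [V0' [_ uniq0]] := exc.
  (* With [V0] the only exception, a third member of the pencil has the same image point as V; that
     point lies in both, hence in X. *)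
  pose V3 := (X + <[v0 + v]>)%VS.
  have nVs : v0 + v \notin V by rewrite rpredDr.
  have nV0s : v0 + v \notin V0 by rewrite rpredDl.
  have LV3 : L V3.
    split; first exact: addvSl.
    split; last by rewrite dim_add_line ?dX //; apply: contra nVs; exact: (subvP XV).
    rewrite subv_add (subv_trans XV0 V0W) -memvE rpredD //.
      exact: (subvP V0W).
    exact: (subvP VW).
  case c3: (chi V3) => [P3|]; last first.
    have V03 : V0 = V3 by rewrite -(uniq0 V0 (conj LV0 c0)) (uniq0 V3 (conj LV3 c3)).
    by case/negP: nV0s; rewrite V03 memvE; exact: addvSr.
  have P3Y : P3 = Y by apply/imY; exists V3.
  have : b \in V3 by rewrite memvE -PE PY -P3Y; exact: chi_in.
  case/memv_add_lineP => u Xu [c bE]; rewrite PE -memvE bE.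
  have [->|c0'] := eqVneq c 0; first by rewrite scale0r addr0.
  move: Vb; rewrite bE rpredDl; last exact: (subvP XV).
  by rewrite rpredZeq (negPf c0') (negPf nVs).
- by have := none V LV; rewrite cV.
Qed.

Definition chi_complex X :=
  \dim X = h.+1 /\ forall V P, (X <= V)%VS -> chi V = Some P -> (P <= X)%VS.

Lemma chi_complex_none V X : chi V = None -> \dim V = h.+2 -> (X <= V)%VS ->
  \dim X = h.+1 -> chi_complex X.
Proof.
move=> cV dV XV dX; split=> // V' P XV'.
by apply: (chi_star dX XV dV XV') => P0; rewrite cV.
Qed.

(** By [chi_star], a single V above X decides for all of them, so [P] acts as the pole of V. *)
Lemma chi_complex_some V X P : chi V = Some P -> (X <= V)%VS ->
  \dim X = h.+1 -> chi_complex X <-> (P <= X)%VS.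
Proof.
move=> cV XV dX; have [dV _] := chi_dim cV.
split=> [[_ inX]|PX]; first exact: (inX V).
split=> // V' P' XV'.
by apply: (chi_star dX XV dV XV') => P0; rewrite cV => -[<-].
Qed.

Lemma chi_complex_proper V P : chi V = Some P ->
  exists X, [/\ \dim X = h.+1, (X <= V)%VS & ~ chi_complex X].
Proof.
move=> cV; have [dV dP] := chi_dim cV; have [b b0 PE] := dim1_line dP.
have Vb : b \in V by rewrite memvE -PE; exact: chi_in.
have [X [XV dX Xb]] := hyperplane_avoiding Vb b0.
have dX' : \dim X = h.+1 by move: dX; rewrite dV => -[].
exists X; split=> // /(chi_complex_some cV XV dX').
by rewrite PE -memvE (negPf Xb).
Qed.

Lemma chi_polarity_spec V : polarity_spec h chi_complex V (chi V).
Proof.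
case cV: (chi V) => [P|] /=.
  have [dV dP] := chi_dim cV; split=> //; split.
    by have [X [dX XV nX]] := chi_complex_proper cV => /(_ X dX XV).
  split=> //; split; first exact: chi_in.
  by move=> X dX XV; exact: (chi_complex_some cV).
have [dV|dV] := eqVneq (\dim V) h.+2; last by left; exact/eqP.
by right=> X dX XV; apply: (chi_complex_none cV).
Qed.

(** The vectors in question form a subspace of codimension at most one, so [exists_functional]
    applies. Both closure properties come from the pole of a subspace [U + <[x]> + <[y]>]. *)
Lemma chi_complex_slot U : \dim U = h ->
  exists2 a : vT -> F, functional a & forall x,
    x \in U \/ chi_complex (U + <[x]>) <-> a x = 0.
Proof.
move=> dU.
have dUx x : x \notin U -> \dim (U + <[x]>) = h.+1.
  by move=> Ux; rewrite dim_add_line ?dU.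
have line_eq x y : y \in (U + <[x]>)%VS -> y \notin U -> (U + <[y]>)%VS = (U + <[x]>)%VS.
  move=> xy Uy; have Ux : x \notin U.
    apply: contra Uy => Ux; have /addv_idPl <- : (<[x]> <= U)%VS by rewrite -memvE.
    exact: xy.
  by apply: add_line_eq; rewrite ?addvSl // dUx ?dU.
have memUx x : x \in (U + <[x]>)%VS by rewrite memvE addvSr.
have UUx x : {subset U <= (U + <[x]>)%VS} by apply/subvP; exact: addvSl.
apply: exists_functional => [c x y Px Py|x y nPy].
  have [Uz|nUz] := boolP (c *: x + y \in U); [by left|right].
  have done_by w : chi_complex (U + <[w]>) -> c *: x + y \in (U + <[w]>)%VS ->
      chi_complex (U + <[c *: x + y]>).
    by move=> Kw zw; rewrite (line_eq w).
  case: Px => [Ux|Kx].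
    case: Py => [Uy|Ky]; first by rewrite rpredD ?rpredZ in nUz.
    by apply: (done_by y) => //; apply: rpredD; [apply: rpredZ; exact: UUx|exact: memUx].
  case: Py => [Uy|Ky].
    by apply: (done_by x) => //; apply: rpredD; [exact: rpredZ|exact: UUx].
  have [xy|nxy] := boolP (y \in (U + <[x]>)%VS).
    by apply: (done_by x) => //; rewrite rpredD ?rpredZ ?memUx.
  pose V := (U + <[x]> + <[y]>)%VS.
  have [dKx _] := Kx; have [dKy _] := Ky.
  have dV : \dim V = h.+2 by rewrite dim_add_line ?dKx.
  have xV : (U + <[x]> <= V)%VS by exact: addvSl.
  have yV : (U + <[y]> <= V)%VS.
    by rewrite subv_add (subv_trans (addvSl _ _) xV) addvSr.
  have zV : (U + <[c *: x + y]> <= V)%VS.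
    rewrite subv_add (subv_trans (addvSl _ _) xV) -memvE rpredD ?rpredZ //.
      exact: (subvP xV).
    exact: (subvP yV).
  case cV: (chi V) => [P|]; last exact: (chi_complex_none cV dV zV (dUx _ nUz)).
  apply/(chi_complex_some cV zV (dUx _ nUz)).
  have [_ dP] := chi_dim cV; have [b b0 PE] := dim1_line dP.
  move/(chi_complex_some cV xV dKx): Kx; move/(chi_complex_some cV yV dKy): Ky.
  rewrite PE -!memvE => yb xb.
  (* The pole lies in [U + <[x]>] and in [U + <[y]>], hence in U and in every subspace above U. *)
  have [u Uu [d bE]] := memv_add_lineP _ _ _ yb.
  have [d0|d0] := eqVneq d 0; first by rewrite bE d0 scale0r addr0 UUx.
  case/negP: nxy; move: xb; rewrite bE rpredDl; last exact: UUx.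
  by rewrite rpredZeq (negPf d0).
have nUy : y \notin U by apply/negP => Uy; apply: nPy; left.
have [xy|nxy] := boolP (x \in (U + <[y]>)%VS).
  have [u Uu [c xE]] := memv_add_lineP _ _ _ xy.
  by exists c; left; rewrite xE addrK.
pose V := (U + <[y]> + <[x]>)%VS.
have dV : \dim V = h.+2 by rewrite dim_add_line ?dUx.
have yV : (U + <[y]> <= V)%VS by exact: addvSl.
case cV: (chi V) => [P|]; last first.
  by case: nPy; right; apply: (chi_complex_none cV dV yV (dUx _ nUy)).
have [_ dP] := chi_dim cV; have [b b0 PE] := dim1_line dP.
have Vb : b \in V by rewrite memvE -PE; exact: chi_in.
(* The pole is [u + c *: y + d *: x], with [d] nonzero because [U + <[y]>] is not in the complex.
   Hence [x + (c / d) *: y] spans, with U, a subspace through the pole. *)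
have [_ /memv_add_lineP [u Uu [c ->]] [d bE]] := memv_add_lineP _ _ _ Vb.
have d0 : d != 0.
  apply: contra_not_neq nPy => d0; right.
  apply/(chi_complex_some cV yV (dUx _ nUy)).
  by rewrite PE -memvE bE d0 scale0r addr0 rpredD ?rpredZ ?memUx ?UUx.
exists (- (c / d)); right; rewrite scaleNr opprK; set z := x + _.
have nUz : z \notin U.
  apply: contra nxy => Uz; rewrite -(addrK ((c / d) *: y) x) -/z.
  by rewrite rpredB ?rpredZ ?memUx ?UUx.
have zV : (U + <[z]> <= V)%VS.
  rewrite subv_add (subv_trans (addvSl _ _) yV) -memvE rpredD ?rpredZ //.
    by rewrite memvE addvSr.
  exact: (subvP yV).
apply/(chi_complex_some cV zV (dUx _ nUz)).
rewrite PE -memvE (_ : b = u + d *: z); last first.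
  by rewrite bE scalerDr scalerA mulrCA divff // mulr1 -addrA [c *: y + _]addrC.
by rewrite rpredD ?rpredZ ?memUx ?UUx.
Qed.

Lemma chi_complex_geomhyp :
  geomhyp h.+1 (fun s => \dim <<s>> = h.+1 -> chi_complex <<s>>).
Proof.
split=> [s t _ st|x s szs xs|s [szs]].
- by rewrite (eq_span (perm_mem st)).
- rewrite span_cons (addv_idPr _) -?memvE ?memv_span // => ds.
  by have := dim_span s; rewrite ds -szs ltnn.
have [dU|dU] := eqVneq (\dim <<s>>) h; last first.
  (* If [s] is dependent, [x :: s] never spans dimension [h.+1], so the condition holds for all
     [x]. *)
  exists (fun _ => 0) => [c x y|x]; first by rewrite mulr0 addr0.
  split=> // _ dx; case/eqP: dU; apply/eqP.
  rewrite eqn_leq -[X in (_ <= X)%N]szs dim_span /= -ltnS -dx span_cons addvC.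
  have [sx|sx] := boolP (x \in <<s>>%VS); last by rewrite dim_add_line.
  by rewrite (addv_idPl _) // -memvE.
have [a la ak] := chi_complex_slot dU; exists a => // x; rewrite -ak span_cons addvC.
split=> [kx|[sx|Kx] //].
  have [sx|sx] := boolP (x \in <<s>>%VS); [by left|right].
  by apply: kx; rewrite dim_add_line ?dU.
by rewrite (addv_idPl _) -?memvE // dU => /n_Sn.
Qed.

End LinearMapping.

(** * Linear complexes, alternating forms and geometric hyperplanes *)

Section LinearComplex.
Variables (F : fieldType) (n h : nat).
Implicit Types (s : seq 'rV[F]_n.+1) (K : {vspace 'rV[F]_n.+1} -> Prop).

Lemma rows_mx_surj (M : 'M[F]_(h.+1, n.+1)) :
  exists s, [/\ size s = h.+1, @rows_mx F n h s = M & <<s>>%VS = rowspan M].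
Proof.
exists [seq row i M | i : 'I_h.+1]; split=> //; first by rewrite size_map size_enum_ord.
apply/matrixP => i j; rewrite mxE (nth_map i) ?size_enum_ord // nth_ord_enum.
by rewrite mxE.
Qed.

Lemma rowspan_rows_mx s : size s = h.+1 -> rowspan (@rows_mx F n h s) = <<s>>%VS.
Proof.
move=> szs; congr (<<_>>%VS); apply: (@eq_from_nth _ 0) => [|i].
  by rewrite size_map size_enum_ord szs.
rewrite size_map size_enum_ord => ip.
rewrite (nth_map (Ordinal ip)) ?size_enum_ord //.
by apply/rowP => j; rewrite !mxE nth_enum_ord.
Qed.

Lemma plucker_spanP c (X : {vspace 'rV[F]_n.+1}) :
  (forall M : 'M[F]_(h.+1, n.+1), rowspan M = X -> plucker_form c M = 0) <->
  (forall s, size s = h.+1 -> <<s>>%VS = X -> plucker_form c (@rows_mx F n h s) = 0).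
Proof.
split=> [cM s szs sX|cs M MX]; first by apply: cM; rewrite rowspan_rows_mx.
have [s [szs sM sX]] := rows_mx_surj M.
by rewrite -sM; apply: cs; rewrite // sX.
Qed.

Lemma linear_complex_altform K : linear_complex h K ->
  exists2 f, altform h.+1 f & forall X, K X <->
    \dim X = h.+1 /\ forall s, size s = h.+1 -> <<s>>%VS = X -> f s = 0.
Proof.
move=> [c [_ KX]]; exists (fun s => plucker_form c (@rows_mx F n h s)).
  exact: plucker_altform.
by move=> X; rewrite KX plucker_spanP.
Qed.

Lemma dual_polarity_spec K V : linear_complex h K ->
  polarity_spec h K V (dual_polarity h K V).
Proof.
case/linear_complex_altform => f af Kf.
have [dV|dV] := eqVneq (\dim V) h.+2; last first.
  by apply: (@dual_polarityP _ _ _ _ _ None); left; exact/eqP.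
have [tot|ntot] := classic (total_sub h K V).
  by apply: (@dual_polarityP _ _ _ _ _ None); right.
have [P pP] := exists_pole af Kf dV ntot.
exact: (@dual_polarityP _ _ _ _ _ (Some P)).
Qed.

Lemma geomhyp_linear_complex K : (exists2 X, \dim X = h.+1 & ~ K X) ->
  (forall X, K X -> \dim X = h.+1) ->
  geomhyp h.+1 (fun s => \dim <<s>> = h.+1 -> K <<s>>%VS) -> linear_complex h K.
Proof.
move=> [X0 dX0 nK] dK /geomhyp_altform [f af kf].
have [c fc] := altform_plucker af.
have KE X : K X <-> \dim X = h.+1 /\
    forall M : 'M[F]_(h.+1, n.+1), rowspan M = X -> plucker_form c M = 0.
  rewrite plucker_spanP; split=> [KX|[dX cX]].
    split=> [|s szs sX]; first exact: dK.
    by rewrite -fc //; apply/kf; rewrite ?sX.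
  have sX : <<vbasis X>>%VS = X by apply: span_basis; exact: vbasisP.
  have szX : size (vbasis X) = h.+1 by rewrite size_tuple dX.
  by rewrite -sX; apply: (kf _ szX).2; [rewrite fc // cX|rewrite sX].
(* Were all coefficients at increasing maps zero, the form would vanish identically and K would
   contain [X0]. *)
exists c; split=> //; apply: NNPP => none; apply/nK/KE; split=> // M _.
rewrite /plucker_form big1 // => g ig.
have [->|cg] := eqVneq (c g) 0; first by rewrite mul0r.
by case: none; exists g; rewrite ig.
Qed.

End LinearComplex.

(** * Existence and uniqueness of the complex *)

Theorem theorem5p7 (F : fieldType) (n h : nat) (hn : (h.+2 <= n)%N)
  (chi : partial_map 'rV[F]_n.+1) :
  linear_mapping h.+1 0 chi ->
  (exists V, chi V <> None) ->
  (forall V P, chi V = Some P -> (P <= V)%VS) ->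
  exists K : {vspace 'rV[F]_n.+1} -> Prop,
    (linear_complex h K /\ forall V, chi V = dual_polarity h K V) /\
    forall K' : {vspace 'rV[F]_n.+1} -> Prop,
      linear_complex h K' -> (forall V, chi V = dual_polarity h K' V) ->
      forall X, K' X <-> K X.
Proof.
move=> lchi [V0 dom] chi_in.
exists (chi_complex h chi); split; first split.
- apply: geomhyp_linear_complex; last exact: chi_complex_geomhyp.
    case c0: (chi V0) dom => [P0|] // _.
    by have [X [dX _ nX]] := chi_complex_proper lchi chi_in c0; exists X.
  by move=> X [].
- move=> V; have spec := chi_polarity_spec lchi chi_in V.
  exact: polarity_spec_uniq spec (dual_polarityP spec).
move=> K' lK' cK' X.
have dK' : K' X -> \dim X = h.+1 by case: lK' => c [_ KX] /KX [].
suff KX : \dim X = h.+1 -> (K' X <-> chi_complex h chi X).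
  split=> [KX'|KX']; first exact: (KX (dK' KX')).1.
  by have [dX _] := KX'; exact: (KX dX).2.
move=> dX.
(* As [h.+1 < n.+1], some V of dimension [h.+2] lies above X, and [chi V] decides membership of X in
   both complexes. *)
have [v _ nXv] : exists2 v, v \in fullv & v \notin X.
  apply/subvPn/negP => /dimvS; rewrite dimvf dX /dim /= mul1n; lia.
pose V := (X + <[v]>)%VS; have dV : \dim V = h.+2 by rewrite dim_add_line ?dX.
have XV : (X <= V)%VS by exact: addvSl.
have := dual_polarity_spec V lK'; rewrite -cK'.
case cV: (chi V) => [P|] /=.
  move=> [_ [_ [_ [_ pX]]]]; rewrite (pX X dX XV).
  exact: iff_sym (chi_complex_some lchi chi_in cV XV dX).
case=> // tot; split=> _; last exact: tot.
exact: (chi_complex_none lchi chi_in cV dV XV dX).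
Qed.
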